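(* Let $0<\epsilon<1/8$ be a fixed constant. Suppose $p=p(n)\in(0,1)$ satisfies $1-p=\Omega(1)$ and $p\ge n^{-1/8+\epsilon}$. Then for every positive integer $\ell=\ell(n)\le n/2$ with $\ell=\Omega(n\sqrt p)$, $$\frac{\ln\!\big(e^{\beta_{n,\ell}^2/2}X_{n,\ell}/\lambda_{n,\ell}\big)}{\beta_{n,\ell}}\xrightarrow{d}\mathcal{N}(0,1)\quad\text{as } n\to\infty,$$ where $\beta_{n,\ell}=\ell\sqrt{(1-p)/(pN)}$ and $N=\binom n2$.
   Context: $\mathcal{G}(n,p)$ is the binomial random graph on vertex set $[n]$ in which each edge is present independently with probability $p$. An $\ell$-matching is a matching with exactly $\ell$ edges; $X_{n,\ell}$ is the number of $\ell$-matchings contained in $\mathcal{G}(n,p)$ and $\lambda_{n,\ell}=\mathbf{E}X_{n,\ell}=\binom{n}{2\ell}\frac{(2\ell)!}{2^\ell\ell!}p^\ell$. $\mathcal{N}(0,1)$ is the standard normal distribution. All asymptotics are as $n\to\infty$; $1-p=\Omega(1)$ means $1-p$ is bounded away from $0$. *)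

(* Defs.v *)
From HB Require Import structures.
From mathcomp Require Import all_boot all_order all_algebra.
From mathcomp Require Import all_classical all_reals all_analysis.
From mathcomp Require Import measurable_realfun.

Set Implicit Arguments.
Unset Strict Implicit.
Unset Printing Implicit Defensive.

Import Order.TTheory GRing.Theory Num.Theory.
Import numFieldNormedType.Exports.

Local Open Scope classical_set_scope.
Local Open Scope ring_scope.

Definition edge (n : nat) := {e : {set 'I_n} | #|e| == 2%N}.
HB.instance Definition _ (n : nat) := Finite.on (edge n).

(* A graph on 'I_n is identified with its set of edges. *)
Definition graph (n : nat) := {set edge n}.
HB.instance Definition _ (n : nat) := Finite.on (graph n).
HB.instance Definition _ (n : nat) := isPointed.Build (graph n) finset.set0.
HB.instance Definition _ (n : nat) := @isMeasurable.Build
  default_measure_display (graph n) discrete_measurable discrete_measurable0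
  discrete_measurableC discrete_measurableU.

Lemma measurable_fun_graph (n : nat) d (T : measurableType d)
  (f : graph n -> T) : measurable_fun [set: graph n] f.
Proof. by []. Qed.

Definition gnp_pmf (R : realType) (n : nat) (p : R) (G : graph n) : R :=
  \prod_(e : edge n) (if e \in G then p else 1 - p).

(* G(n, p); as for [bernoulli_prob], a junk Dirac mass when p is outside
   [0, 1], so that it is a probability measure for every p. *)
Definition gnp_prob (R : realType) (n : nat) (p : R) : set (graph n) -> \bar R :=
  fun A => if 0 <= p <= 1 then (\sum_(G \in A) (gnp_pmf p G)%:E)%E
           else \d_(finset.set0 : graph n) A.
Arguments gnp_prob {R} n p.

Section gnp_probability.
Context {R : realType} (n : nat) (p : R).

Local Notation gnp := (gnp_prob n p).

Lemma gnp_pmf_ge0 (G : graph n) : 0 <= p <= 1 -> 0 <= gnp_pmf p G.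
Proof.
move=> /andP[p0 p1]; apply: prodr_ge0 => e _.
by case: ifP => // _; rewrite subr_ge0.
Qed.

Lemma sum_gnp_pmf : \sum_(G : graph n) gnp_pmf p G = 1.
Proof.
transitivity (\prod_(e : edge n) (p + (1 - p))).
  by rewrite bigA_distr; apply: eq_bigl => G; rewrite inE.
by rewrite big1 // => e _; rewrite addrC subrK.
Qed.

Let gnp0 : gnp set0 = 0%E.
Proof. by rewrite /gnp_prob; case: ifPn => // p01; rewrite fsbig_set0. Qed.

Let gnp_ge0 A : (0 <= gnp A)%E.
Proof.
rewrite /gnp_prob; case: ifPn => // p01.
rewrite fsbig_finite//= sumEFin lee_fin.
by apply: sumr_ge0 => /= G _; exact: gnp_pmf_ge0.
Qed.

Let gnp_sigma_additive : semi_sigma_additive gnp.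
Proof.
move=> F mF tF mUF; rewrite /gnp_prob; case: ifPn => p01; last first.
  exact: measure_semi_sigma_additive.
apply: cvg_toP.
  apply: ereal_nondecreasing_is_cvgn => m k mk.
  apply: lee_sum_nneg_natr => // i _ _.
  rewrite fsbig_finite//= sumEFin lee_fin.
  by apply: sumr_ge0 => /= G _; exact: gnp_pmf_ge0.
transitivity (\sum_(0 <= i <oo) (\esum_(G in F i) (gnp_pmf p G)%:E))%E.
  apply: eq_eseriesr => k _; rewrite esum_fset//= => G _.
  by rewrite lee_fin gnp_pmf_ge0.
rewrite -nneseries_sum_bigcup//=; last first.
  by move=> G; rewrite lee_fin gnp_pmf_ge0.
by rewrite esum_fset//= => G _; rewrite lee_fin gnp_pmf_ge0.
Qed.

HB.instance Definition _ := isMeasure.Build _ _ _ gnp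
  gnp0 gnp_ge0 gnp_sigma_additive.

Let gnp_setT : gnp [set: _] = 1%E.
Proof.
rewrite /gnp_prob; case: ifPn => [p01|_]; last exact: probability_setT.
rewrite (fsbigE (index_enum (graph n))) ?index_enum_uniq//=.
- under eq_bigl do rewrite in_setT.
  by rewrite sumEFin sum_gnp_pmf.
- by move=> G _ /negP[]; rewrite mem_index_enum.
Qed.

HB.instance Definition _ :=
  @Measure_isProbability.Build _ _ R gnp gnp_setT.

End gnp_probability.

Definition is_matching (n : nat) (M : {set edge n}) : bool :=
  finset.trivIset (val @: M).

Definition nb_matchings (n l : nat) (G : graph n) : nat :=
  #|[pred M : {set edge n} | [&& M \subset G, #|M| == l & is_matching M]]|.

Definition lambda (R : realType) (n l : nat) (p : R) : R :=
  fine ('E_(gnp_prob n p)[fun G : graph n => (nb_matchings l G)%:R]).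

Definition beta (R : realType) (n l : nat) (p : R) : R :=
  l%:R * Num.sqrt ((1 - p) / (p * 'C(n, 2)%:R)).

(* Extended-real valued: [lne 0 = -oo], reached when G has no l-matching. *)
Definition log_matchings (R : realType) (n l : nat) (p : R) (G : graph n) :
    \bar R :=
  (lne (expR (beta n l p ^+ 2 / 2) * (nb_matchings l G)%:R / lambda n l p)%:E
   * ((beta n l p)^-1)%:E)%E.
Arguments log_matchings {R} n l p G.

HB.instance Definition _ (R : realType) (n l : nat) (p : R) :=
  isMeasurableFun.Build _ _ _ _ (log_matchings n l p)
    (measurable_fun_graph (log_matchings n l p)).

(* Convergence of distribution functions at the continuity points of the limit
   law mu. As mu is carried by R, this forces the probabilities that Y n is
   infinite to tend to 0. *)
Definition cvg_in_distribution (R : realType) (d : nat -> measure_display)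
    (T : forall n, measurableType (d n)) (P : forall n, probability (T n) R)
    (Y : forall n, {RV (P n) >-> \bar R}) (mu : probability (measurableTypeR R) R) : Prop :=
  forall x : R, mu [set x] = 0%E ->
    distribution (P n) (Y n) [set y | (y <= x%:E)%E] @[n --> \oo]
      --> mu [set y | y <= x].

(* Main.v *)
Require Import Defs.
From HB Require Import structures.
From mathcomp Require Import all_boot all_order all_algebra.
From mathcomp Require Import all_classical all_reals all_analysis.
From mathcomp Require Import measurable_realfun.
From mathcomp Require Import ring lra zify.

Set Implicit Arguments.
Unset Strict Implicit.
Unset Printing Implicit Defensive.

Import Order.TTheory GRing.Theory Num.Theory.
Import numFieldNormedType.Exports.

(* Conditionally on the number m of edges the graph is uniform, with
   mu_m = T 'C(m, l) / 'C(N, l) matchings of size l on average, where T is their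
   number in the complete graph and N = 'C(n, 2). Expanding the second moment of
   the number X of l-matchings over the sets of j edges common to two matchings
   gives E X^2 / mu_m^2 = \sum_j w_j r_j, where r_j = 'C(N, j) / T_j compares the
   number of j-sets of edges with the number T_j of j-matchings. The same
   expansion for arbitrary l-sets of edges instead of matchings, whose number is
   constant, shows \sum_j w_j = 1. Now r_j is close to 1 for j up to a J with
   1 / p << J << sqrt n, and w_(j+1) r_(j+1) = O(1 / (p j)) w_j r_j, so
   that large j contribute little: X / mu_m -> 1 in probability when p^2 n -> oo.
   The fluctuations of X are therefore those of mu_m / lambda; with
   m = N p + Z sqrt(N p (1 - p)), a Taylor expansion gives
   ln (mu_m / lambda) = beta Z - beta^2 / 2 + O(1 / (p^2 n)), and Z is
   asymptotically normal. The latter is proved by Lindeberg's method, replacing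
   the edges one at a time by normal increments. *)

(** * Second moment of the number of sets of a downward closed family *)

(** As [b + c = a], the factor ['C(a, b + j)] is the usual ['C(a, c - j)] of Vandermonde's identity,
    but it also vanishes for [j > c], where a truncated subtraction would not. Induction on [k] by
    Pascal's rule. *)
Lemma Vandermonde_compl (k a b c : nat) : (b + c = a)%N ->
  'C(k + a, c) = (\sum_(j < k.+1) 'C(k, j) * 'C(a, b + j))%N.
Proof.
elim: k b c => [|k IHk] b c bc.
  by rewrite big_ord1 bin0 mul1n addn0 add0n -bc -[in RHS]bin_sub ?leq_addr// addKn.
rewrite big_ord_recl bin0 mul1n addn0.
under eq_bigr do rewrite /= /bump /= binS mulnDl addnS -addSn.
rewrite big_split /= addnA; set A := (X in _ = (X + _)%N).
have -> : A = 'C(k + a, c).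
  rewrite (IHk b c)// /A [RHS]big_ord_recl bin0 mul1n addn0.
  rewrite [X in (_ + X)%N = _]big_ord_recr /= (@bin_small k k.+1)// mul0n addn0; congr addn.
  by apply: eq_bigr => i _; rewrite /= /bump /= add1n addSnnS.
case: c bc => [|c] bc; last by rewrite addSn binS -(IHk b.+1 c)//; lia.
rewrite !bin0 big1 ?addn0// => i _.
by rewrite [X in (_ * X)%N]bin_small ?muln0//; lia.
Qed.

(** Complements of supersets of [U] are subsets of [~: U]. Choosing the [#|T| - m] absent elements
    keeps the formula right when [#|U| > m]: the binomial is then 0. *)
Lemma card_supersets (T : finType) (U : {set T}) (m : nat) : (m <= #|T|)%N ->
  #|[set G : {set T} | (U \subset G) && (#|G| == m)]| = 'C(#|T| - #|U|, #|T| - m).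
Proof.
move=> mT; have -> : (#|T| - #|U|)%N = #|~: U| by rewrite [RHS]cardsCs finset.setCK.
have <- := cards_draws (~: U) (#|T| - m).
rewrite -(card_imset _ (@finset.setC_inj T)); congr #|pred_of_set _|.
apply/finset.setP => G; rewrite -[G]finset.setCK (mem_imset _ _ (@finset.setC_inj T)).
rewrite !inE finset.setCS; congr (_ && _); apply/eqP/eqP => GE.
  by rewrite cardsCs finset.setCK GE.
by have := cardsC (~: G); rewrite GE; lia.
Qed.

(** * Families whose one-element extensions are counted by the size alone *)

Section Extensions.
(** Two families are meant: matchings, with [d j = 'C(n - j.*2, 2)], and all sets, with
    [d j = #|T| - j]. The second one normalises the weights met with the first. *)
Context (T : finType) (P : pred {set T}) (d : nat -> nat) (P0 : P finset.set0)
  (Pdown : forall A B : {set T}, A \subset B -> P B -> P A)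
  (Pd : forall S : {set T}, P S ->
    #|[set f | (f \notin S) && P (f |: S)]| = d #|S|).

Definition exts (S : {set T}) (i : nat) :=
  [set M : {set T} | [&& S \subset M, P M & #|M| == (#|S| + i)%N]].

(** Double counting of the pairs of an extension [M] and an element [f] of [M :\: S]: every [M] has
    [i.+1] of them. *)
Lemma card_extsS (S : {set T}) (i : nat) :
  (#|exts S i.+1| * i.+1 =
   \sum_(f in [set f | (f \notin S) && P (f |: S)]) #|exts (f |: S) i|)%N.
Proof.
transitivity (\sum_(M in exts S i.+1) \sum_(f in M :\: S) 1)%N.
  rewrite -sum_nat_const; apply: eq_bigr => M; rewrite inE => /and3P[SM _ /eqP cM].
  by rewrite sum1_card cardsD (finset.setIidPr SM) cM addKn.
rewrite (exchange_big_dep (mem [set f | (f \notin S) && P (f |: S)])) /=.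
  apply: eq_bigr => f; rewrite inE => /andP[fS PfS].
  rewrite -sum1_card; apply: eq_bigl => M.
  rewrite !inE fS /= finset.subUset finset.sub1set cardsU1 fS addnS.
  by case: (f \in M); rewrite /= ?andbT ?andbF.
move=> M f; rewrite !inE => /and3P[SM PM _] /andP[-> fM] /=.
by apply: Pdown PM; rewrite finset.subUset finset.sub1set fM.
Qed.

(** Both sides count the ordered ways of adding [i] elements one by one; downward closure keeps
    every intermediate set in the family. *)
Lemma card_exts (S : {set T}) (i : nat) : P S ->
  (#|exts S i| * i`! = \prod_(t < i) d (#|S| + t))%N.
Proof.
elim: i S => [|i IHi] S PS.
  rewrite big_ord0 muln1 (_ : exts S 0 = [set S]) ?cards1//.
  apply/finset.setP => M; rewrite !inE addn0; apply/and3P/eqP => [[SM _ /eqP cM]|->//].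
  by apply/esym/eqP; rewrite eqEcard SM cM /=.
rewrite factS mulnA card_extsS big_distrl /=.
under eq_bigr => f.
  rewrite inE => /andP[fS PfS]; rewrite (IHi _ PfS) cardsU1 fS.
  under eq_bigr do rewrite add1n addSnnS.
  over.
rewrite sum_nat_const Pd// big_ord_recl addn0; congr muln.
Qed.

(** With T_j the number of members of size j, this says that a member of size j lies in T_l 'C(l, j)
    / T_j members of size l. The ordered counts agree because building from the empty set passes
    through size j. *)
Lemma card_exts_set0 (S : {set T}) (l : nat) : P S -> (#|S| <= l)%N ->
  (#|exts finset.set0 (#|S|)%N| * #|exts S (l - #|S|)| =
   #|exts finset.set0 l| * 'C(l, #|S|))%N.
Proof.
move=> PS Sl; set j := #|S|.
apply/eqP; rewrite -(eqn_pmul2r (fact_gt0 j)) -(eqn_pmul2r (fact_gt0 (l - j))).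
rewrite [X in _ == X](_ : _ = (#|exts finset.set0 l| * l`!)%N); last first.
  by rewrite -(bin_fact Sl) -/j; ring.
rewrite [X in X == _](_ : _ = ((#|exts finset.set0 j| * j`!) *
  (#|exts S (l - j)| * (l - j)`!))%N); last ring.
rewrite !card_exts// finset.cards0 -(subnKC Sl) big_split_ord /= -/j addKn.
exact/eqP.
Qed.

Lemma mem_exts0 (M : {set T}) (l : nat) :
  (M \in exts finset.set0 l) = P M && (#|M| == l).
Proof. by rewrite inE finset.sub0set finset.cards0. Qed.

Lemma exts0_gt0 (j l : nat) : (j <= l)%N ->
  (0 < #|exts finset.set0 l|)%N -> (0 < #|exts finset.set0 j|)%N.
Proof.
move=> jl Tl; have := card_exts l P0; have := card_exts j P0; rewrite finset.cards0.
have : (0 < #|exts finset.set0 l| * l`!)%N by rewrite muln_gt0 Tl fact_gt0.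
move=> /[swap] Ej /[swap] ->; rewrite -(subnKC jl) big_split_ord /= muln_gt0 -Ej.
by move=> /andP[+ _]; rewrite muln_gt0 => /andP[].
Qed.

Definition nb_sub (l : nat) (G : {set T}) :=
  #|[set M : {set T} | [&& M \subset G, #|M| == l & P M]]|.

Lemma sum_nb_sub (l m : nat) : (m <= #|T|)%N ->
  (\sum_(G : {set T} | #|G| == m) nb_sub l G =
   #|exts finset.set0 l| * 'C(#|T| - l, #|T| - m))%N.
Proof.
move=> mT.
under eq_bigr do rewrite /nb_sub -sum1_card.
rewrite (exchange_big_dep (mem (exts finset.set0 l))) /=; last first.
  by move=> G M _; rewrite mem_exts0 inE => /and3P[_ -> ->].
rewrite -sum_nat_const; apply: eq_bigr => M.
rewrite mem_exts0 => /andP[PM /eqP cM].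
rewrite -{2}cM -card_supersets// -sum1_card; apply: eq_bigl => G.
by rewrite !inE PM cM eqxx !andbT andbC.
Qed.

Lemma sum_nb_sub_sqr_pairs (l m : nat) : (m <= #|T|)%N ->
  (\sum_(G : {set T} | #|G| == m) nb_sub l G ^ 2 =
   \sum_(M in exts finset.set0 l) \sum_(M' in exts finset.set0 l)
     'C(#|T| - #|M :|: M'|, #|T| - m))%N.
Proof.
move=> mT.
transitivity (\sum_(G : {set T} | #|G| == m)
    \sum_(M in [set M : {set T} | [&& M \subset G, #|M| == l & P M]]) nb_sub l G)%N.
  by apply: eq_bigr => G _; rewrite sum_nat_const mulnn.
rewrite (exchange_big_dep (mem (exts finset.set0 l))) /=; last first.
  by move=> G M _; rewrite mem_exts0 inE => /and3P[_ -> ->].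
apply: eq_bigr => M; rewrite mem_exts0 => /andP[PM cM].
under eq_bigr do rewrite /nb_sub -sum1_card.
rewrite (exchange_big_dep (mem (exts finset.set0 l))) /=; last first.
  by move=> G M' _; rewrite mem_exts0 inE => /and3P[_ -> ->].
apply: eq_bigr => M'; rewrite mem_exts0 => /andP[PM' cM'].
rewrite -card_supersets// -sum1_card; apply: eq_bigl => G.
by rewrite !inE PM PM' cM cM' finset.subUset !andbT; case: (_ == m); rewrite ?andbT ?andbF.
Qed.

(* Vandermonde's identity expands the number of supersets of M :|: M' in the
   binomials 'C(#|M :&: M'|, j), which count the j-subsets common to M and M'. *)
Lemma sum_nb_sub_sqr (l m : nat) : (m <= #|T|)%N -> (l.*2 <= m)%N ->
  (\sum_(G : {set T} | #|G| == m) nb_sub l G ^ 2 =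
   \sum_(j < l.+1) 'C(#|T| - l.*2, m - l.*2 + j) *
      \sum_(S : {set T} | P S && (#|S| == j)) #|exts S (l - j)| ^ 2)%N.
Proof.
move=> mT lm; rewrite sum_nb_sub_sqr_pairs//.
transitivity (\sum_(M in exts finset.set0 l) \sum_(M' in exts finset.set0 l)
   \sum_(j < l.+1) 'C(#|M :&: M'|, j) * 'C(#|T| - l.*2, m - l.*2 + j))%N.
  apply: eq_bigr => M; rewrite mem_exts0 => /andP[PM /eqP cM].
  apply: eq_bigr => M'; rewrite mem_exts0 => /andP[PM' /eqP cM'].
  have kl : (#|M :&: M'| <= l)%N by rewrite -cM subset_leq_card// finset.subsetIl.
  rewrite cardsU cM cM' addnn.
  rewrite (_ : #|T| - _ = #|M :&: M'| + (#|T| - l.*2))%N; last lia.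
  rewrite (@Vandermonde_compl _ _ (m - l.*2)); last lia.
  rewrite (big_ord_widen l.+1 (fun j => 'C(#|M :&: M'|, j) * 'C(#|T| - l.*2, m - l.*2 + j))%N)//.
  rewrite big_mkcond; apply: eq_bigr => i _; case: ltnP => // ki.
  by rewrite bin_small.
under eq_bigr do rewrite exchange_big /=.
rewrite exchange_big /=; apply: eq_bigr => j _.
under eq_bigr do rewrite -big_distrl /=.
rewrite -big_distrl /= mulnC; congr muln.
under eq_bigr => M _ do under eq_bigr => M' _ do rewrite -cards_draws -sum1_card.
under eq_bigr => M HM.
  rewrite (exchange_big_dep (fun S : {set T} => [&& S \subset M, P S & #|S| == j])) /=.
    over.
  move=> M' S _; rewrite inE finset.subsetI => /andP[/andP[SM _] ->]; rewrite SM andbT /=.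
  by apply: Pdown SM _; move: HM; rewrite mem_exts0 => /andP[].
rewrite (exchange_big_dep (fun S : {set T} => P S && (#|S| == j))) /=; last first.
  by move=> M S _ /and3P[_ -> ->].
apply: eq_bigr => S /andP[PS /eqP cS].
rewrite -mulnn -[X in (X * _)%N]sum1_card big_distrl /=.
have jl : (j <= l)%N by rewrite -ltnS.
have extE (M : {set T}) : (M \in exts finset.set0 l) && (S \subset M) = (M \in exts S (l - j)).
  by rewrite mem_exts0 inE cS subnKC// andbC.
apply: eq_big => [M|M /andP[_ /and3P[SM _ _]]].
  by rewrite -extE PS cS eqxx !andbT.
rewrite mul1n -sum1_card; apply: eq_bigl => M'.
by rewrite -extE; congr (_ && _); rewrite inE finset.subsetI SM cS eqxx andbT.
Qed.

(** Each of the T_j sets [S] contributes the square of T_l 'C(l, j) / T_j, which leaves a single T_j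
    in the denominator. *)
Lemma sum_nb_sub_sqr_R (R : realType) (l m : nat) : (m <= #|T|)%N -> (l.*2 <= m)%N ->
  (0 < #|exts finset.set0 l|)%N ->
  (\sum_(G : {set T} | #|G| == m) (nb_sub l G)%:R ^+ 2 =
   #|exts finset.set0 l|%:R ^+ 2 * \sum_(j < l.+1) 'C(#|T| - l.*2, m - l.*2 + j)%:R *
      'C(l, j)%:R ^+ 2 / #|exts finset.set0 j|%:R :> R)%R.
Proof.
move=> mT lm Tl.
under eq_bigr do rewrite -natrX.
rewrite -natr_sum sum_nb_sub_sqr// natr_sum big_distrr /=; apply: eq_bigr => j _.
have jl : (j <= l)%N by rewrite -ltnS.
have Tj : (0 < #|exts finset.set0 j|)%N by apply: exts0_gt0 Tl.
apply: (mulIf (x := #|exts finset.set0 j|%:R%R)); first by rewrite pnatr_eq0 -lt0n.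
rewrite mulrA divfK; last by rewrite pnatr_eq0 -lt0n.
rewrite -!natrX -!natrM; congr (_%:R)%R.
apply/eqP; rewrite -(eqn_pmul2r Tj); apply/eqP.
transitivity ('C(#|T| - l.*2, m - l.*2 + j) *
  \sum_(S : {set T} | P S && (#|S| == j))
     (#|exts finset.set0 j| * #|exts S (l - j)|) ^ 2)%N.
  rewrite -!mulnA; congr muln; rewrite mulnn big_distrl /=.
  by apply: eq_bigr => S _; rewrite expnMn mulnC.
under eq_bigr => S /andP[PS /eqP cS].
  have := @card_exts_set0 S l PS; rewrite cS => /(_ jl) ->.
  over.
rewrite sum_nat_const (_ : #|_| = #|exts finset.set0 j|); last first.
  by apply: eq_card => S; rewrite mem_exts0.
by rewrite !expnMn; ring.
Qed.

End Extensions.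

(** * Matchings in the uniform graph with m edges *)

Section Matchings.
Context (n : nat).
Implicit Types (S M G : {set edge n}) (f : edge n).

Lemma card_edge : #|{: edge n}| = 'C(n, 2).
Proof.
rewrite card_sig -[n in RHS]card_ord -card_draws.
by apply: eq_card => A; rewrite !inE.
Qed.

Lemma is_matching0 : is_matching (finset.set0 : {set edge n}).
Proof. by apply/finset.trivIsetP => A B; rewrite finset.imset0 inE. Qed.

Lemma is_matchingS S M : S \subset M -> is_matching M -> is_matching S.
Proof.
move=> SM; apply: finset.trivIsetS; exact: finset.imsetS.
Qed.

Lemma card_cover_matching S : is_matching S -> #|finset.cover (val @: S)| = #|S|.*2.
Proof.
move=> /eqP <-; rewrite big_imset /=; last by move=> ? ? _ _; exact: val_inj.
rewrite (eq_bigr (fun=> 2%N)); first by rewrite sum_nat_const muln2.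
by move=> f _; exact/eqP/(valP f).
Qed.

Lemma is_matchingU1 S f : is_matching S ->
  (f \notin S) && is_matching (f |: S) = (val f \subset ~: finset.cover (val @: S)).
Proof.
move=> mS; rewrite -finset.disjoints_subset.
have fne : val f != finset.set0 by rewrite -finset.card_gt0 (eqP (valP f)).
apply/andP/idP => [[fS /finset.trivIsetP mfS]|dfS].
  rewrite /finset.cover; apply/bigcup_disjointP => A /imsetP[g gS ->].
  apply: mfS; rewrite ?imset_f// ?inE ?eqxx ?gS ?orbT//.
  by apply: contraNneq fS => /val_inj ->.
have fSn : f \notin S.
  apply: contraTN dfS => fS; rewrite -setI_eq0 (finset.setIidPl _)//.
  by apply: (finset.bigcup_sup (val f)) => //; exact: imset_f.
split=> //; rewrite /is_matching finset.imsetU1.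
have [|//|//|//] := @trivIsetU1 _ (val f) (val @: S).
- by move=> B BS; apply: disjointWr dfS; rewrite /finset.cover (bigD1 B)//= finset.subsetUl.
- apply/imsetP => -[g _ g0]; have := valP g.
  by rewrite -g0 finset.cards0.
Qed.

(** A matching covers two vertices per edge, and an edge extends it exactly when it is a pair of
    uncovered vertices. *)
Lemma card_matching_ext S : is_matching S ->
  #|[set f | (f \notin S) && is_matching (f |: S)]| = 'C(n - #|S|.*2, 2).
Proof.
move=> mS; set C := finset.cover (val @: S).
have -> : (n - #|S|.*2)%N = #|~: C|.
  by rewrite [RHS]cardsCs finset.setCK card_ord card_cover_matching.
rewrite -cards_draws -(card_imset _ val_inj); apply: eq_card => A.
apply/imsetP/idP => [[f]|].
  by rewrite !inE (is_matchingU1 _ mS) => fC ->; rewrite fC (valP f).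
rewrite inE => /andP[AC A2]; exists (Sub A A2) => //.
by rewrite inE (is_matchingU1 _ mS).
Qed.

(* The number of l-matchings of the complete graph. *)
Definition nbm (l : nat) : nat := #|exts (@is_matching n) finset.set0 l|.

Lemma nbm_fact (l : nat) : (nbm l * l`! = \prod_(t < l) 'C(n - t.*2, 2))%N.
Proof.
rewrite /nbm (@card_exts _ _ (fun j => 'C(n - j.*2, 2)) is_matchingS card_matching_ext) ?is_matching0//.
by rewrite finset.cards0.
Qed.

Lemma nbmS (l : nat) : (nbm l.+1 * l.+1 = 'C(n - l.*2, 2) * nbm l)%N.
Proof.
apply/eqP; rewrite -(eqn_pmul2r (fact_gt0 l)) -!mulnA -factS !nbm_fact.
by rewrite big_ord_recr /= mulnC.
Qed.

Lemma nbm_gt0 (l : nat) : (l.*2 <= n)%N -> (0 < nbm l)%N.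
Proof.
move=> ln; suff : (0 < nbm l * l`!)%N by rewrite muln_gt0 => /andP[].
by rewrite nbm_fact prodn_gt0// => t; rewrite bin_gt0; have := ltn_ord t; lia.
Qed.

Lemma nb_matchingsE (l : nat) G : nb_matchings l G = nb_sub (@is_matching n) l G.
Proof. by rewrite /nb_sub cardsE. Qed.

End Matchings.

Lemma card_exts_predT (T : finType) (l : nat) :
  #|exts xpredT (finset.set0 : {set T}) l| = 'C(#|T|, l).
Proof.
rewrite -cardsT -cards_draws; apply: eq_card => M.
by rewrite mem_exts0 inE finset.subsetT.
Qed.

(** The second moment formula for the family of all sets: every set of size [m] has the same number
    ['C(m, l)] of subsets of size [l], so the left side is immediate. *)
Lemma sum_bin_sqr (R : realType) (N l m : nat) : (m <= N)%N -> (l.*2 <= m)%N ->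
  ('C(N, m)%:R * 'C(m, l)%:R ^+ 2 =
   'C(N, l)%:R ^+ 2 * \sum_(j < l.+1) 'C(N - l.*2, m - l.*2 + j)%:R *
      'C(l, j)%:R ^+ 2 / 'C(N, j)%:R :> R)%R.
Proof.
have [T <-] : exists T : finType, #|T| = N by exists 'I_N; rewrite card_ord.
move=> mT lm.
have Pd (S : {set T}) : xpredT S -> #|[set f | (f \notin S) && true]| = (#|T| - #|S|)%N.
  move=> _; rewrite [RHS](_ : _ = #|~: S|); last by rewrite [RHS]cardsCs finset.setCK.
  by apply: eq_card => f; rewrite !inE andbT.
have := @sum_nb_sub_sqr_R T xpredT _ isT (fun _ _ _ _ => isT) Pd R l m mT lm.
rewrite card_exts_predT bin_gt0 (_ : (l <= #|T|)%N); last lia.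
move=> /(_ isT); rewrite [X in X = _ -> _](_ : _ = 'C(#|T|, m)%:R * 'C(m, l)%:R ^+ 2)%R.
  by move=> ->; congr (_ * _)%R; apply: eq_bigr => j _; rewrite card_exts_predT.
rewrite (eq_bigr (fun=> 'C(m, l)%:R ^+ 2)%R); last first.
  move=> G /eqP cG; rewrite -[in RHS]cG -cards_draws; congr (_%:R ^+ 2)%R.
  by apply: eq_card => M; rewrite !inE andbT.
rewrite sumr_const [RHS]mulr_natl; congr (_ *+ _)%R.
by rewrite -card_draws; apply: eq_card => G; rewrite !inE.
Qed.

(** * Elementary estimates and identities for binomial coefficients *)

Local Open Scope ring_scope.

Lemma bin2R (R : realType) (k : nat) : 'C(k, 2)%:R = k%:R * (k%:R - 1) / 2 :> R.
Proof.
elim: k => [|k IHk]; first by rewrite bin0n mul0r mul0r.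
by rewrite binS bin1 natrD IHk -(natr1 k); field.
Qed.

Lemma bernoulli_inequality (R : realType) (x : R) (k : nat) : 0 <= x <= 1 ->
  1 - k%:R * x <= (1 - x) ^+ k.
Proof.
move=> /andP[x0 x1]; elim: k => [|k IHk]; first by rewrite mul0r subr0.
have : (1 - x) * (1 - k%:R * x) <= (1 - x) * (1 - x) ^+ k by rewrite ler_wpM2l// subr_ge0.
rewrite exprS; apply: le_trans; rewrite -natr1.
have : 0 <= k%:R * x ^+ 2 by rewrite mulr_ge0// sqr_ge0.
nra.
Qed.

Lemma bin_bin (N m l : nat) : (l <= m)%N -> (m <= N)%N ->
  ('C(N, m) * 'C(m, l) = 'C(N, l) * 'C(N - l, N - m))%N.
Proof.
move=> lm mN; apply/eqP.
rewrite -(eqn_pmul2r (fact_gt0 l)) -(eqn_pmul2r (fact_gt0 (m - l))).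
rewrite -(eqn_pmul2r (fact_gt0 (N - m))).
have E1 := bin_fact lm; have E2 := bin_fact mN; have E3 := bin_fact (leq_trans lm mN).
have := @bin_fact (N - l) (N - m); rewrite (_ : N - l - (N - m) = m - l)%N; last lia.
rewrite leq_sub2l// => /(_ isT) E4.
rewrite [X in X == _](_ : _ = 'C(N, m) * (('C(m, l) * (l`! * (m - l)`!)) * (N - m)`!))%N; last ring.
rewrite E1 E2
  [X in _ == X](_ : _ = 'C(N, l) * (l`! * ('C(N - l, N - m) * ((N - m)`! * (m - l)`!))))%N; last ring.
by rewrite E4 E3.
Qed.

(** * Variance of the number of matchings at a fixed number of edges *)

Section MatchingVariance.
Context (R : realType) (n l m : nat)
  (ln : (l.*2 <= n)%N) (lm : (l.*2 <= m)%N) (mN : (m <= 'C(n, 2))%N).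
Local Notation N := 'C(n, 2).

(* The mean number of l-matchings of the uniform graph with m edges. *)
Definition mean_m : R := (nbm n l)%:R * 'C(m, l)%:R / 'C(N, l)%:R.

(** Up to one common factor, [w j / 'C(N, j)] is the weight w_j of the overview and [V j] is the
    product w_j r_j. *)
Let w (j : nat) : R := 'C(N - l.*2, m - l.*2 + j)%:R * 'C(l, j)%:R ^+ 2.
Let V (j : nat) : R := w j / (nbm n j)%:R.

Let w_ge0 j : 0 <= w j.
Proof. by rewrite mulr_ge0// exprn_ge0. Qed.

Let V_ge0 j : 0 <= V j.
Proof. by rewrite divr_ge0. Qed.

Let nbmR_gt0 j : (j <= l)%N -> 0 < (nbm n j)%:R :> R.
Proof. by move=> jl; rewrite ltr0n nbm_gt0//; lia. Qed.

Let binNl_gt0 j : (j <= l)%N -> 0 < 'C(N, j)%:R :> R.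
Proof. by move=> jl; rewrite ltr0n bin_gt0; lia. Qed.

(** The quotient of consecutive terms has three factors: one from the binomial in [w], at most [B];
    the quotient of (l - j)^2 by the number of free vertex pairs, at most 1 since 2l <= n; and 1 /
    (j + 1). *)
Lemma V_rec (B : R) (j : nat) : (j < l)%N ->
  (N - m)%:R <= B * (m - l.*2 + 1)%:R -> V j.+1 * j.+1%:R <= B * V j.
(* The bound [cge] comes from (l - j)^2 <= 'C(2(l - j), 2). *)
Proof.
move=> jl NB.
have Tj := nbmR_gt0 (ltnW jl); have Tj1 := nbmR_gt0 jl.
have cge : (l - j)%:R ^+ 2 <= 'C(n - j.*2, 2)%:R :> R.
  rewrite -natrX ler_nat (leq_trans _ (leq_bin2l 2 (_ : (l - j).*2 <= _)%N))//; last lia.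
  rewrite bin2 -mul2n -mulnA mul2n doubleK -mulnn leq_mul2l; lia.
have c0 : 0 < 'C(n - j.*2, 2)%:R :> R by rewrite ltr0n bin_gt0; lia.
have E1 : (nbm n j.+1)%:R = 'C(n - j.*2, 2)%:R * (nbm n j)%:R / j.+1%:R :> R.
  by rewrite -natrM -nbmS natrM mulfK// pnatr_eq0.
have E2 : 'C(l, j.+1)%:R = (l - j)%:R * 'C(l, j)%:R / j.+1%:R :> R.
  by rewrite -natrM -mul_bin_left mulnC natrM mulfK// pnatr_eq0.
have E3 : 'C(N - l.*2, m - l.*2 + j.+1)%:R <= B * 'C(N - l.*2, m - l.*2 + j)%:R :> R.
  set a := (N - l.*2)%N; set b := (m - l.*2 + j)%N.
  have H : b.+1%:R * 'C(a, b.+1)%:R = (a - b)%:R * 'C(a, b)%:R :> R by rewrite -!natrM mul_bin_left.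
  rewrite addnS -/b -(ler_pM2l (ltr0Sn R b)) H mulrCA [X in _ <= X]mulrA ler_wpM2r//.
  apply: le_trans (_ : (N - m)%:R <= _); first by rewrite ler_nat; lia.
  apply: (le_trans NB); have B0 : 0 <= B.
    by rewrite -(pmulr_lge0 _ (ltr0Sn R (m - l.*2))) -addn1; apply: le_trans NB.
  rewrite ler_wpM2l// ler_nat; lia.
rewrite /V /w E1 E2.
set c := 'C(n - j.*2, 2)%:R in cge c0 *; set T := (nbm n j)%:R in Tj *.
set b := 'C(l, j)%:R; set d := (l - j)%:R in cge *; set C1 := 'C(_, _ + j.+1)%:R in E3 *.
set C0 := 'C(_, _)%:R in E3 *.
have k0 : (j.+1%:R : R) != 0 by rewrite pnatr_eq0.
move: k0; set k := (j.+1%:R : R) => k0.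
rewrite [X in X <= _](_ : _ = (C1 * (b ^+ 2 / T)) * (d ^+ 2 / c)); last first.
  by field; rewrite ?k0 ?lt0r_neq0.
have bT : 0 <= b ^+ 2 / T by rewrite divr_ge0 ?exprn_ge0.
apply: (@le_trans _ _ (C1 * (b ^+ 2 / T))).
  rewrite ler_piMr ?ler_pdivrMr ?mul1r//.
  exact: mulr_ge0.
rewrite [X in _ <= X](_ : _ = B * C0 * (b ^+ 2 / T)); last by rewrite !mulrA.
by rewrite ler_wpM2r.
Qed.

(** Up to [j]!, there are at most N^j sets of [j] edges and at least c^j matchings, where c = 'C(n -
    2J, 2) bounds from below the choices at every step. As N / c >= 1, the exponent can be raised to
    [J]. *)
Lemma ratio_bound (J j : nat) : (J.*2.+2 <= n)%N -> (j <= J)%N -> (j <= l)%N ->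
  (nbm n j)%:R^-1 <= (N%:R / 'C(n - J.*2, 2)%:R) ^+ J / 'C(N, j)%:R :> R.
Proof.
move=> Jn jJ jl; set c := 'C(n - J.*2, 2).
have c0 : 0 < c%:R :> R by rewrite ltr0n bin_gt0; lia.
have cN : c%:R <= N%:R :> R by rewrite ler_nat leq_bin2l// leq_subr.
have j0 : 0 < (j`!)%:R :> R by rewrite ltr0n fact_gt0.
have H1 : c%:R ^+ j <= (nbm n j)%:R * (j`!)%:R :> R.
  rewrite -natrM nbm_fact -natrX ler_nat -[X in (_ ^ X)%N]card_ord -prod_nat_const.
  by apply: leq_prod => t _; rewrite leq_bin2l//; have := ltn_ord t; lia.
have H2 : 'C(N, j)%:R * (j`!)%:R <= N%:R ^+ j :> R.
  rewrite -natrM bin_ffact -natrX ler_nat ffact_prod.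
  rewrite -[X in (_ <= _ ^ X)%N]card_ord -prod_nat_const.
  by apply: leq_prod => t _; exact: leq_subr.
rewrite ler_pdivlMr ?binNl_gt0// mulrC ler_pdivrMr ?nbmR_gt0//.
rewrite -(ler_pM2r j0); apply: (le_trans H2).
apply: (@le_trans _ _ ((N%:R / c%:R) ^+ j * ((nbm n j)%:R * (j`!)%:R))).
  rewrite expr_div_n -mulrA ler_peMr ?exprn_ge0// mulrC ler_pdivlMr ?exprn_gt0//.
  by rewrite mul1r.
rewrite mulrA !ler_wpM2r// ler_weXn2l//.
by rewrite ler_pdivlMr// mul1r.
Qed.

(** Terms up to [J] are compared with the normalised weights. The others are handled as in Markov's
    inequality, with [B] bounding the mean of j under the weights [V]. *)
Lemma sumV_le (B : R) (J : nat) : (0 < J)%N -> (J.*2.+2 <= n)%N ->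
  (N - m)%:R <= B * (m - l.*2 + 1)%:R ->
  (\sum_(j < l.+1) V j) * (1 - B / J%:R) <=
  (N%:R / 'C(n - J.*2, 2)%:R) ^+ J * \sum_(j < l.+1) w j / 'C(N, j)%:R.
Proof.
move=> J0 Jn NB; set S := \sum_(j < _) V j; set r := _ ^+ J.
have J0R : 0 < J%:R :> R by rewrite ltr0n.
have r0 : 0 <= r by rewrite exprn_ge0// divr_ge0.
rewrite mulrBr mulr1 lerBlDr.
(* The recurrence, summed over j, bounds the first moment of [V]. *)
have HS : \sum_(j < l.+1) V j * j%:R <= B * S.
  rewrite big_ord_recl mulr0 add0r /S big_ord_recr /= mulrDr.
  have B0 : 0 <= B.
    by rewrite -(pmulr_lge0 _ (ltr0Sn R (m - l.*2))) -addn1; apply: le_trans NB.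
  rewrite -[X in X <= _]addr0 lerD ?mulr_ge0// mulr_sumr; apply: ler_sum => i _.
  by rewrite /bump /= add1n; exact: V_rec.
apply: (@le_trans _ _ (\sum_(j < l.+1) (r * (w j / 'C(N, j)%:R) + V j * j%:R / J%:R))).
  apply: ler_sum => j _; have jl : (j <= l)%N by rewrite -ltnS.
  have [jJ|Jj] := leqP j J.
    rewrite -[X in X <= _]addr0 lerD//; last by rewrite divr_ge0 ?mulr_ge0.
    by rewrite /V mulrCA ler_wpM2l// ratio_bound.
  (* Beyond [J] one has 1 <= j / J, so the second summand alone suffices. *)
  rewrite -[X in X <= _]add0r lerD//; first by rewrite mulr_ge0// divr_ge0.
  by rewrite -mulrA ler_peMr// ler_pdivlMr// mul1r ler_nat ltnW.
rewrite big_split /= -mulr_sumr lerD2l -mulr_suml mulrA (mulrC S).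
by rewrite ler_wpM2r// invr_ge0 ltW.
Qed.

(** Removing 2J vertices loses at most a fraction 8J / n of the pairs; Bernoulli's inequality then
    handles the power. *)
Lemma bernoulli_ratio (J : nat) : (J.*2.+2 <= n)%N ->
  1 - 8 * J%:R ^+ 2 / n%:R <= ('C(n - J.*2, 2)%:R / N%:R) ^+ J :> R.
Proof.
move=> Jn; set c := 'C(n - J.*2, 2).
have n2 : 2 <= n%:R :> R by rewrite ler_nat; lia.
have N0 : 0 < N%:R :> R by rewrite ltr0n bin_gt0; lia.
have cN : c%:R <= N%:R :> R by rewrite ler_nat leq_bin2l// leq_subr.
have cE : c%:R = (n%:R - J%:R * 2) * (n%:R - J%:R * 2 - 1) / 2 :> R.
  by rewrite /c bin2R natrB -?muln2 ?natrM//; lia.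
have NE : N%:R = n%:R * (n%:R - 1) / 2 :> R by rewrite bin2R.
have := @bernoulli_inequality R (1 - c%:R / N%:R) J.
rewrite subKr => H; apply: le_trans (H _); last first.
  by rewrite subr_ge0 ler_pdivrMr// mul1r cN lerBlDr lerDl divr_ge0.
rewrite lerD2l lerN2 expr2 mulrA mulrAC [8 * J%:R / _ * _]mulrC -mulrA ler_wpM2l//.
rewrite lerBlDr -lerBlDl ler_pdivlMr// mulrBl mul1r.
have J0 : 0 <= J%:R :> R by [].
rewrite NE cE; set x := n%:R in n2 *; set y := J%:R in J0 *.
have -> : 8 * (y / x) * (x * (x - 1) / 2) = 4 * y * (x - 1) by field; lra.
nra.
Qed.

(** Taking B = delta J in the splitting at [J], the ratio of the second moment to the squared mean
    is at most (1 - delta)^-2, hence at most 1 + 4 delta as delta <= 1/4. *)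
Lemma matching_variance (J : nat) (delta : R) : 0 < delta <= 4^-1 -> (0 < J)%N ->
  8 * J%:R ^+ 2 <= delta * n%:R ->
  (N - m)%:R <= delta * J%:R * (m - l.*2 + 1)%:R ->
  \sum_(G : {set edge n} | #|G| == m) ((nb_matchings l G)%:R - mean_m) ^+ 2
    <= 4 * delta * ('C(N, m)%:R * mean_m ^+ 2).
Proof.
move=> /andP[d0 d4] J0 Jn NB.
have J0R : 0 < J%:R :> R by rewrite ltr0n.
have Jn2 : (J.*2.+2 <= n)%N.
  have : (32 * J ^ 2 <= n)%N.
    rewrite -(ler_nat R) natrM natrX; move: Jn d4 (ler0n R n); nra.
  by rewrite -mulnn; nia.
have n0 : 0 < n%:R :> R by rewrite ltr0n; lia.
have N0 : 0 < N%:R :> R by rewrite ltr0n bin_gt0; lia.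
have c0 : 0 < 'C(n - J.*2, 2)%:R :> R by rewrite ltr0n bin_gt0; lia.
have HV := sumV_le J0 Jn2 NB; rewrite mulfK ?gt_eqF// in HV.
have HB := bernoulli_ratio Jn2.
have d1 : 1 - delta <= ('C(n - J.*2, 2)%:R / N%:R) ^+ J.
  apply: le_trans HB; rewrite lerD2l lerN2 ler_pdivrMr//.
have TE : 0 < 'C(N, l)%:R :> R by exact: binNl_gt0.
have HX : \sum_(G : {set edge n} | #|G| == m) (nb_matchings l G)%:R ^+ 2 =
    (nbm n l)%:R ^+ 2 * \sum_(j < l.+1) V j :> R.
  under eq_bigr do rewrite nb_matchingsE.
  rewrite (@sum_nb_sub_sqr_R _ _ (fun j => 'C(n - j.*2, 2)) (is_matching0 n)
    (@is_matchingS n) (@card_matching_ext n)).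
  - by rewrite card_edge.
  - by rewrite card_edge.
  - by [].
  - exact: nbm_gt0.
have lm1 : (l <= m)%N by apply: leq_trans lm; rewrite -addnn leq_addr.
have mE : (m <= #|{: edge n}|)%N by rewrite card_edge.
have HX1 : \sum_(G : {set edge n} | #|G| == m) (nb_matchings l G)%:R =
    'C(N, m)%:R * mean_m :> R.
  under eq_bigr do rewrite nb_matchingsE.
  rewrite -natr_sum (sum_nb_sub _ _ mE) card_edge// natrM /mean_m -/(nbm n l).
  rewrite mulrCA -!mulrA; congr *%R.
  rewrite mulrA -natrM (mulnC 'C(m, l)) bin_bin//.
  by rewrite natrM mulrAC mulfV ?mul1r// gt_eqF.
(* The identity for arbitrary edge sets expresses the squared mean through the same weights, so that
   only two sums have to be compared. *)
have HW : 'C(N, m)%:R * mean_m ^+ 2 = (nbm n l)%:R ^+ 2 * \sum_(j < l.+1) w j / 'C(N, j)%:R.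
  have := sum_bin_sqr R mN lm; rewrite -/w /mean_m.
  move: ('C(N, m)%:R : R) ('C(m, l)%:R : R) (\sum_(j < _) _) ((nbm n l)%:R : R) TE.
  move: ('C(N, l)%:R : R) => c a b s t c1 E.
  have -> : s = a * b ^+ 2 / c ^+ 2 by rewrite E mulrC mulKf// expf_neq0// gt_eqF.
  by field; rewrite gt_eqF.
have -> : \sum_(G : {set edge n} | #|G| == m) ((nb_matchings l G)%:R - mean_m) ^+ 2 =
  \sum_(G : {set edge n} | #|G| == m) (nb_matchings l G)%:R ^+ 2
   - 'C(N, m)%:R * mean_m ^+ 2.
  under eq_bigr do rewrite sqrrB.
  rewrite big_split sumrB /= sumrMnl -mulr_suml HX1 sumr_const.
  rewrite (_ : #|_| = 'C(N, m)); first by rewrite -mulr_natl; ring.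
  by rewrite -card_edge -card_draws; apply: eq_card => G; rewrite !inE.
rewrite HX HW; set S := \sum_(j < _) V j in HV *; set W := \sum_(j < _) _ in HV *.
set T2 := _ ^+ 2; rewrite mulrCA -mulrBr ler_wpM2l ?exprn_ge0//.
set r := _ ^+ J in HV; set r' := _ ^+ J in d1.
(* One factor 1 - delta is lost to the large j, and [r' >= 1 - delta] loses the other. *)
have rr : r * r' = 1.
  by rewrite -exprMn mulrA divfK ?mulfV ?expr1n// gt_eqF.
have W0 : 0 <= W by apply: sumr_ge0 => i _; rewrite divr_ge0.
have S0 : 0 <= S by apply: sumr_ge0 => i _.
have r0 : 0 <= r by rewrite exprn_ge0// divr_ge0// ltW.
rewrite lerBlDr -[X in _ + X]mul1r -mulrDl.
have q0 : 0 < (1 - delta) ^+ 2 by rewrite exprn_gt0//; lra.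
rewrite -(ler_pM2r q0); apply: (@le_trans _ _ W).
  have : S * (1 - delta) * (1 - delta) <= r * W * r'.
    by rewrite ler_pM// ?mulr_ge0//; lra.
  by rewrite [r * W * r']mulrAC rr mul1r -mulrA -expr2.
by rewrite mulrAC ler_peMl//; nra.
Qed.
End MatchingVariance.

(** * A central limit theorem for the binomial law *)

Local Open Scope classical_set_scope.
Local Open Scope ring_scope.

(** * The normal distribution function and its Taylor estimates *)

Section NormalCdf.
Context {R : realType}.
Local Notation mu := lebesgue_measure.
Implicit Types (x y s K : R).

Definition phi : R -> R := normal_pdf 0 1.
Definition Phi (x : R) : R := fine (normal_prob (0 : R) 1 `]-oo, x]%classic).

Lemma phiE x : phi x = normal_peak 1 * expR (- (x ^+ 2 / 2)).
Proof.
by rewrite /phi normal_pdfE ?oner_neq0// /normal_fun subr0 expr1n mulr2n mulNr.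
Qed.

Lemma PhiE x : normal_prob (0 : R) 1 `]-oo, x]%classic = (Phi x)%:E.
Proof. by rewrite fineK// fin_num_measure. Qed.

Lemma Phi_ge0 x : 0 <= Phi x.
Proof. by rewrite -lee_fin -PhiE. Qed.

Lemma Phi_le1 x : Phi x <= 1.
Proof. by rewrite -lee_fin -PhiE probability_le1. Qed.

Lemma Phi_le : {homo Phi : x y / x <= y}.
Proof.
move=> x y xy; rewrite -lee_fin -!PhiE le_measure ?inE//.
by apply: subset_itvl; rewrite bnd_simp.
Qed.

Lemma Phi_Rintegral : Phi = (fun x => \int[mu]_(t in `]-oo, x]) phi t).
Proof. by []. Qed.

Lemma is_derive_Phi x : is_derive x 1 Phi (phi x).
Proof.
have [] := @continuous_FTC1 R phi -oo%O x (x + 1) _ _ _ _.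
- by rewrite ltrDl.
- apply: (integrableS _ _ (subsetT _)) => //; exact: integrable_normal_pdf.
- by rewrite ltNyr.
- exact/continuous_normal_pdf/oner_neq0.
rewrite Phi_Rintegral derive1E => dF <-; exact/derivableP.
Qed.

Lemma is_derive_phi x : is_derive x 1 phi (- (x * phi x)).
Proof.
rewrite [X in is_derive _ _ X _](_ : _ = (fun x => normal_peak 1 * expR (- (x ^+ 2 / 2)))); last first.
  by apply/funext => y; rewrite phiE.
by apply: is_derive_eq; rewrite phiE /GRing.scale /=; field.
Qed.

Lemma phi_ge0 x : 0 <= phi x.
Proof. exact: normal_pdf_ge0. Qed.

Lemma normal_peak1_le1 : normal_peak 1 <= 1 :> R.
Proof.
have pi2 := pi_ge2 R.
have : 1 <= Num.sqrt (1 ^+ 2 * pi *+ 2) :> R.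
  rewrite -[X in X <= _]sqrtr1 ler_sqrt expr1n mul1r mulr2n; lra.
by rewrite /normal_peak => p1; rewrite invf_le1// (lt_le_trans ltr01).
Qed.

(** Both 1 + t and 1 + t^2 / 2 lie below exp t for t = x^2 / 2. This one bound controls every
    derivative of [Phi] needed below. *)
Lemma phi_moments x : (1 + x ^+ 2 + x ^+ 4) * phi x <= 11.
Proof.
set t := x ^+ 2 / 2; have t0 : 0 <= t by rewrite divr_ge0// sqr_ge0.
have E1 : expR t >= 1 + t by exact: expR_ge1Dx.
have E2 : expR t >= 1 + t ^+ 2 / 2 by have := @expR_ge1Dxn R t 1 t0; rewrite (_ : 2`! = 2)%N.
have -> : 1 + x ^+ 2 + x ^+ 4 = 1 + 2 * t + 4 * t ^+ 2 by rewrite /t; field.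
rewrite phiE -/t expRN mulrA ler_pdivrMr ?expR_gt0//.
apply: (@le_trans _ _ (1 + 2 * t + 4 * t ^+ 2)).
  rewrite ler_piMr ?normal_peak1_le1//; have := sqr_ge0 t; lra.
lra.
Qed.

(** The identity as a random variable under the normal law; its distribution function is [Phi],
    whose limits at infinity are then available. *)
Let idTR : measurableTypeR R -> R := idfun.

#[local] HB.instance Definition _ :=
  @isMeasurableFun.Build _ _ _ _ idTR (@measurable_id _ _ setT).

Lemma Phi_tail (e : R) : 0 < e -> exists2 K : R, 0 < K & Phi (- K) <= e /\ 1 - e <= Phi K.
Proof.
move=> e0; pose X : {RV (normal_prob 0 1 : probability _ R) >-> R} := idTR.
have hy : Phi r @[r --> +oo] --> (1 : R).
  by have /fine_cvgP[_] := cvg_cdfy1 X.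
have hNy : Phi (- r) @[r --> +oo] --> (0 : R).
  by have /cvgNy_compNP/fine_cvgP[_] := cvg_cdfNy0 X.
near (pinfty_nbhs R) => K; exists K; first by near: K; exact: nbhs_pinfty_gt.
split.
- have : `|0 - Phi (- K)| <= e by near: K; move/cvgrPdist_le: hNy; apply.
  by rewrite sub0r normrN; apply: le_trans; exact: ler_norm.
- have : `|1 - Phi K| <= e by near: K; move/cvgrPdist_le: hy; apply.
  by move=> /(le_trans (ler_norm _)); rewrite lerBlDr lerBlDl.
Unshelve. all: by end_near. Qed.

(** A mean value inequality raising the order by one; iterating it gives Taylor remainders. The
    conditions on [u] say that it lies between 0 and [s], whatever the sign of [s]. *)
Lemma deriv_bound (F f : R -> R) (s K : R) (k : nat) : F 0 = 0 ->
  (forall u, `|u| <= `|s| -> 0 <= u * s -> is_derive u 1 F (f u)) ->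
  (forall u, `|u| <= `|s| -> 0 <= u * s -> `|f u| <= K * `|u| ^+ k) ->
  `|F s| <= K * `|s| ^+ k.+1.
Proof.
move=> F0 dF fK.
have K0 : 0 <= K * `|s| ^+ k by apply: le_trans (fK s _ _); rewrite // -expr2 sqr_ge0.
have main (c : R) : `|c| <= `|s| -> 0 <= c * s -> `|f c * s| <= K * `|s| ^+ k.+1.
  move=> cs c0; rewrite normrM exprS mulrCA (mulrC `|s|) ler_wpM2r//.
  apply: (le_trans (fK c cs c0)).
  (* The sign of [K] can be read off [K0] only for nonzero [s]. *)
  have [s0|s0] := eqVneq s 0.
    by move: cs; rewrite s0 normr0 normr_le0 => /eqP ->; rewrite normr0.
  have {}K0 : 0 <= K by move: K0; rewrite pmulr_lge0// exprn_gt0// normr_gt0.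
  by rewrite ler_wpM2l// lerXn2r// ?nnegrE.
have [s0|s0] := leP 0 s.
  have inI u : u \in `[0, s] -> `|u| <= `|s| /\ 0 <= u * s.
    by rewrite in_itv/= => /andP[u0 us]; rewrite !ger0_norm// mulr_ge0.
  have [||c /inI[c1 c2]] := @MVT_segment R F f 0 s s0.
  - by move=> x /subset_itv_oo_cc /inI[? ?]; exact: dF.
  - apply: derivable_within_continuous => x /inI[x1 x2].
    by have [] := dF x x1 x2.
  by rewrite F0 !subr0 => ->; exact: main.
have inI u : u \in `[s, 0] -> `|u| <= `|s| /\ 0 <= u * s.
  rewrite in_itv/= => /andP[us u0]; have s1 := ltW s0.
  by rewrite !ler0_norm// lerN2 mulr_le0.
have [||c /inI[c1 c2]] := @MVT_segment R F f s 0 (ltW s0).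
- by move=> x /subset_itv_oo_cc /inI[? ?]; exact: dF.
- apply: derivable_within_continuous => x /inI[x1 x2].
  by have [] := dF x x1 x2.
by rewrite F0 !sub0r mulrN => /oppr_inj ->; exact: main.
Qed.

Lemma Phi_lipschitz x y : `|Phi x - Phi y| <= `|x - y|.
Proof.
have := @deriv_bound (fun u => Phi (y + u) - Phi y) (fun u : R => phi (y + u)) (x - y) 1 0.
rewrite addr0 subrr (addrC y) subrK expr1 mul1r; apply => //.
- move=> u _ _; have := is_derive_Phi (y + u) => dP.
  apply: is_derive_eq; rewrite /GRing.scale/=; lra.
- move=> u _ _; rewrite expr0 mulr1 ger0_norm ?phi_ge0//.
  apply: le_trans (normal_pdf_ub _ _ (oner_neq0 _)) _; exact: normal_peak1_le1.
Qed.

(** The third derivative (x^2 - 1) phi(x) is bounded by 12, and three applications of [deriv_bound]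
    bring this back to [Phi]. *)
Lemma Phi_taylor y s :
  `|Phi (y + s) - Phi y - s * phi y + s ^+ 2 / 2 * (y * phi y)| <= 12 * `|s| ^+ 3.
Proof.
have d1 u : is_derive (u : R) (1 : R) (fun u : R => phi (y + u)) (- ((y + u) * phi (y + u))).
  have := is_derive_phi (y + u) => dP; apply: is_derive_eq; rewrite /GRing.scale/=; lra.
have d0 u : is_derive (u : R) (1 : R) (fun u : R => Phi (y + u)) (phi (y + u)).
  have := is_derive_Phi (y + u) => dP; apply: is_derive_eq; rewrite /GRing.scale/=; lra.
pose g u := - ((y + u) * phi (y + u)) + y * phi y.
have H2 u : `|g u| <= 12 * `|u| ^+ 1.
  apply: (@deriv_bound g (fun u => ((y + u) ^+ 2 - 1) * phi (y + u))).
  - by rewrite /g addr0 addNr.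
  - move=> v _ _; rewrite /g; have := d1 v => dv.
    apply: is_derive_eq; rewrite /GRing.scale/=; ring.
  - move=> v _ _; rewrite expr0 mulr1; have := phi_moments (y + v); have := phi_ge0 (y + v).
    set c := phi _; set w := y + v => c0 Hc.
    have : 0 <= w ^+ 2 * c by rewrite mulr_ge0// sqr_ge0.
    have : 0 <= w ^+ 4 * c by rewrite mulr_ge0// exprn_even_ge0.
    by move=> w4 w2; rewrite ler_norml; apply/andP; split; lra.
have H1 u : `|phi (y + u) - phi y + u * (y * phi y)| <= 12 * `|u| ^+ 2.
  apply: (@deriv_bound (fun u => phi (y + u) - phi y + u * (y * phi y)) g).
  - by rewrite addr0 subrr mul0r addr0.
  - move=> v _ _; rewrite /g; have := d1 v => dv.
    apply: is_derive_eq; rewrite /GRing.scale/=; ring.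
  - by move=> v _ _; exact: H2.
apply: (@deriv_bound (fun u => Phi (y + u) - Phi y - u * phi y + u ^+ 2 / 2 * (y * phi y))
  (fun u => phi (y + u) - phi y + u * (y * phi y))).
- by rewrite addr0 subrr sub0r expr0n /= !mul0r addr0 oppr0.
- move=> v _ _; have := d0 v => dv.
  by apply: is_derive_eq; rewrite /GRing.scale/=; field.
- by move=> v _ _; exact: H1.
Qed.

(** First order expansion in the variance. By the heat equation its linear term matches the
    quadratic term of [Phi_taylor], which makes the two cancel in [heat_step]. *)
Lemma Phi_time (a v h : R) : 0 < v -> 0 <= h ->
  `|Phi (a / Num.sqrt (v + h)) - Phi (a / Num.sqrt v)
    + h / (2 * v) * (a / Num.sqrt v * phi (a / Num.sqrt v))| <= 12 / v ^+ 2 * h ^+ 2.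
Proof.
move=> v0 h0; pose y t := a / Num.sqrt (v + t).
pose k t := - (2 * (v + t))^-1 * (y t * phi (y t)).
have nneg (u t : R) : 0 <= u -> `|t| <= `|u| -> 0 <= t * u -> 0 <= t.
  move=> u0; rewrite (ger0_norm u0) => tu; have [//|tn] := leP 0 t.
  by rewrite leNgt => /negP[]; rewrite nmulr_rlt0//; move: tu; rewrite ltr0_norm//; lra.
have dy t : 0 < v + t -> is_derive t 1 y (- (2 * (v + t))^-1 * y t).
  move=> vt; rewrite /y.
  have s0 : 0 < Num.sqrt (v + t) by rewrite sqrtr_gt0.
  have sq : Num.sqrt (v + t) ^+ 2 = v + t by rewrite sqr_sqrtr// ltW.
  have d1 : is_derive t 1 (fun t => Num.sqrt (v + t)) (2 * Num.sqrt (v + t))^-1.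
    have := @is_derive1_sqrt R (v + t) vt => dP.
    apply: is_derive_eq; rewrite /GRing.scale/=; ring.
  have sN : Num.sqrt (v + t) != 0 by rewrite gt_eqF.
  have d2 := @is_deriveV R (fun t : R => Num.sqrt (v + t)) _ _ _ sN d1.
  have d3 : is_derive (t : R) (1 : R) (fun t : R => a * (Num.sqrt (v + t))^-1)
     (a * (- (Num.sqrt (v + t)) ^- 2 *: (2 * Num.sqrt (v + t))^-1)).
    by apply: is_derive_eq; rewrite /GRing.scale/=; ring.
  apply: (is_derive_eq d3); rewrite /GRing.scale/=.
  move: sN sq; set q := Num.sqrt _ => sN <-; field.
  by rewrite sN.
have dpsi z : is_derive (z : R) (1 : R) (fun z : R => z * phi z) ((1 - z ^+ 2) * phi z).
  have := is_derive_phi z => dz.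
  by apply: is_derive_eq; rewrite /GRing.scale/=; ring.
have dk t : 0 < v + t ->
    is_derive (t : R) (1 : R) k ((3 * y t - y t ^+ 3) * phi (y t) / (2 * (v + t)) ^+ 2).
  move=> vt; have vt0 : 2 * (v + t) != 0 by rewrite mulf_neq0// gt_eqF.
  have d1 := is_derive1_comp (dpsi (y t)) (dy t vt).
  have d0 : is_derive (t : R) (1 : R) (fun t : R => 2 * (v + t)) 2.
    by apply: is_derive_eq; rewrite /GRing.scale/=; ring.
  have d2 := @is_deriveV R (fun t : R => 2 * (v + t)) _ _ _ vt0 d0.
  rewrite (_ : k = (fun t => - (2 * (v + t))^-1 * ((fun z => z * phi z) \o y) t))//.
  apply: is_derive_eq; rewrite /GRing.scale/=.
  move: (y t) (phi _) => z c; field.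
  by rewrite gt_eqF.
have Hk u : 0 <= u -> `|k u - k 0| <= 12 / v ^+ 2 * `|u| ^+ 1.
  move=> u0; apply: (@deriv_bound (fun u => k u - k 0)
    (fun t => (3 * y t - y t ^+ 3) * phi (y t) / (2 * (v + t)) ^+ 2)).
  - by rewrite subrr.
  - move=> t tu /(nneg _ _ u0 tu) t0; have vt : 0 < v + t by lra.
    have := dk t vt; move: (_ / _) => D dkt.
    by apply: is_derive_eq; rewrite subr0.
  - move=> t tu /(nneg _ _ u0 tu) t0; rewrite expr0 mulr1.
    have := phi_moments (y t); have := phi_ge0 (y t).
    set c := phi _; set z := y t => c0 Hc.
    have Hz : `|3 * z - z ^+ 3| <= 2 * (1 + z ^+ 2 + z ^+ 4).
      (* These squares are the certificate for the polynomial inequality; with [phi_moments] it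
         bounds the numerator of the second derivative by 22. *)
      have := sqr_ge0 (z ^+ 2 + z / 2); have := sqr_ge0 (z ^+ 2 - z / 2).
      have := sqr_ge0 (z - 6 / 7); have := sqr_ge0 (z + 6 / 7).
      have := sqr_ge0 (z ^+ 2) => z1 z2 z3 z4 z5.
      by rewrite ler_norml; apply/andP; split; nra.
    have vt : 0 < (2 * (v + t)) ^+ 2 by rewrite exprn_gt0//; lra.
    rewrite normrM normfV (ger0_norm (ltW vt)) normrM (ger0_norm c0) ler_pdivrMr//.
    rewrite mulrAC ler_pdivlMr ?exprn_gt0//.
    apply: (@le_trans _ _ (22 * v ^+ 2)).
      rewrite ler_wpM2r ?sqr_ge0//; apply: (@le_trans _ _ (2 * (1 + z ^+ 2 + z ^+ 4) * c)).
        by rewrite ler_wpM2r.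
      lra.
    have : v ^+ 2 <= (v + t) ^+ 2 by rewrite lerXn2r ?nnegrE; lra.
    by rewrite exprMn; have := sqr_ge0 v; lra.
have H := @deriv_bound (fun t => Phi (y t) - Phi (y 0) - t * k 0) (fun u => k u - k 0) h
  (12 / v ^+ 2) 1.
have := H; rewrite (ger0_norm h0) => {}H.
have -> : h / (2 * v) * (a / Num.sqrt v * phi (a / Num.sqrt v)) = - (h * k 0).
  by rewrite /k /y addr0; ring.
rewrite -/(y h) (_ : a / Num.sqrt v = y 0); last by rewrite /y addr0.
apply: H.
- by rewrite mul0r !subrr.
- move=> t th th0; have t0 : 0 <= t by apply: (nneg h) => //; rewrite (ger0_norm h0).
  have vt : 0 < v + t by lra.
  have d1 := is_derive1_comp (is_derive_Phi (y t)) (dy t vt).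
  rewrite (_ : (fun t => _) = (fun t => (Phi \o y) t - Phi (y 0) - t * k 0))//.
  by apply: is_derive_eq; rewrite /k /GRing.scale/=; ring.
- move=> t th t0; apply: Hk; by apply: (nneg h) => //; rewrite (ger0_norm h0).
Qed.

(** * Expectations under the binomial law and the replacement of trials by normal increments *)

Definition bin_expect (N : nat) (p : R) (F : nat -> R) : R :=
  \sum_(k < N.+1) 'C(N, k)%:R * p ^+ k * (1 - p) ^+ (N - k) * F k.

(** Conditioning on one trial, by Pascal's rule; this isolates the trial to be replaced. *)
Lemma bin_expectS (N : nat) (p : R) (F : nat -> R) :
  bin_expect N.+1 p F = bin_expect N p (fun k => p * F k.+1 + (1 - p) * F k).
Proof.
rewrite /bin_expect; under [RHS]eq_bigr do rewrite mulrDr.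
rewrite big_split /= big_ord_recl /= [X in _ = _ + X]big_ord_recl /=.
rewrite !bin0 !subn0 expr0 !mulr1 !mul1r.
rewrite addrCA exprSr mulrA; congr (_ + _).
rewrite (eq_bigr (fun i : 'I_N.+1 => 'C(N, i)%:R * p ^+ i * (1 - p) ^+ (N - i) * (p * F i.+1)
   + 'C(N, i.+1)%:R * p ^+ i.+1 * (1 - p) ^+ (N - i) * F i.+1)); last first.
  by move=> i _; rewrite /bump /= add1n binS natrD subSS exprS; ring.
rewrite big_split /=; congr (_ + _).
rewrite big_ord_recr /= bin_small// !mul0r addr0; apply: eq_bigr => i _.
by rewrite /bump /= add1n -(subnSK (ltn_ord i)) [(1 - p) ^+ _.+1]exprS; ring.
Qed.

Lemma bin_expect_le (N : nat) (p : R) (F G : nat -> R) : 0 <= p <= 1 ->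
  (forall k, (k <= N)%N -> F k <= G k) -> bin_expect N p F <= bin_expect N p G.
Proof.
move=> /andP[p0 p1] FG; apply: ler_sum => k _; rewrite ler_wpM2l//.
  by rewrite !mulr_ge0 ?exprn_ge0// subr_ge0.
by apply: FG; rewrite -ltnS.
Qed.

Lemma bin_expectD (N : nat) (p c : R) (F : nat -> R) :
  bin_expect N p (fun k => F k + c) = bin_expect N p F + c.
Proof.
rewrite /bin_expect; under eq_bigr do rewrite mulrDr.
rewrite big_split /= -mulr_suml; congr (_ + _).
have := exprDn (1 - p) p N; rewrite subrK expr1n => E.
rewrite [X in X * _](_ : _ = 1) ?mul1r// [RHS]E; apply: eq_bigr => i _.
by rewrite -mulr_natl; ring.
Qed.

Lemma bin_expect_cst (N : nat) (p c : R) : bin_expect N p (fun=> c) = c.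
Proof.
have E0 : bin_expect N p (fun=> 0) = 0 by rewrite /bin_expect big1// => k _; rewrite mulr0.
have := bin_expectD N p c (fun=> 0); by rewrite E0 add0r => {2}<-.
Qed.

Lemma bin_expect_dist (N : nat) (p e : R) (F G : nat -> R) : 0 <= p <= 1 ->
  (forall k, (k <= N)%N -> `|F k - G k| <= e) ->
  `|bin_expect N p F - bin_expect N p G| <= e.
Proof.
move=> p01 FG; rewrite ler_distl -!bin_expectD; apply/andP; split.
  by apply: bin_expect_le => // k /FG; rewrite ler_distl => /andP[].
by apply: bin_expect_le => // k /FG; rewrite ler_distl => /andP[].
Qed.

(* The probability of x + sqrt(v) Z <= c with Z standard normal: it is the heat
   flow at time v started from the indicator of x <= c. *)
Definition heat (c v x : R) : R := Phi ((c - x) / Num.sqrt v).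

(** A centred two-point step of variance [h] is exchanged for a normal one. The first order terms
    cancel since the mean is 0, the second order ones since the variances agree; third moments and
    the time remainder are left. The bound [delta <= v] makes the error independent of [v]. *)
Lemma heat_step (c v h x p s delta : R) : 0 < delta <= v -> 0 <= h ->
  0 < p < 1 -> 0 <= s -> s ^+ 2 * (p * (1 - p)) = h ->
  `|p * heat c v (x + (1 - p) * s) + (1 - p) * heat c v (x - p * s) - heat c (v + h) x|
    <= 12 * (s / Num.sqrt delta * (h / delta)) + 12 * (h / delta) ^+ 2.
Proof.
move=> /andP[d0 dv] h0 /andP[p0 p1] s0 sh; have v0 : 0 < v by lra.
have sv0 : 0 < Num.sqrt v by rewrite sqrtr_gt0.
have sd0 : 0 < Num.sqrt delta by rewrite sqrtr_gt0.
set w := s / Num.sqrt v; set y := (c - x) / Num.sqrt v.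
have w2 : w ^+ 2 * (p * (1 - p)) = h / v.
  by rewrite /w exprMn exprVn sqr_sqrtr ?ltW// mulrAC sh.
have w0 : 0 <= w by rewrite divr_ge0// ltW.
have wle : w <= s / Num.sqrt delta.
  by rewrite ler_wpM2l// lef_pV2 ?posrE// ler_sqrt// ltW.
have hle : h / v <= h / delta by rewrite ler_wpM2l// lef_pV2 ?posrE.
have hv0 : 0 <= h / v by rewrite divr_ge0// ltW.
have E1 : heat c v (x + (1 - p) * s) = Phi (y + - ((1 - p) * w)).
  by rewrite /heat /y /w; congr Phi; field; rewrite gt_eqF.
have E2 : heat c v (x - p * s) = Phi (y + p * w).
  by rewrite /heat /y /w; congr Phi; field; rewrite gt_eqF.
rewrite E1 E2.
have H1 := Phi_taylor y (- ((1 - p) * w)); have H2 := Phi_taylor y (p * w).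
have H3 := Phi_time (c - x) v0 h0.
rewrite -/y -/(heat c (v + h) x) in H3.
have q0 : 0 <= 1 - p by lra.
rewrite normrN (ger0_norm (mulr_ge0 q0 w0)) in H1.
rewrite (ger0_norm (mulr_ge0 (ltW p0) w0)) in H2.
have E4 : h / (2 * v) = w ^+ 2 * (p * (1 - p)) / 2 by rewrite w2; field; rewrite gt_eqF.
rewrite E4 in H3.
have E3 : 12 / v ^+ 2 * h ^+ 2 = 12 * (h / v) ^+ 2 by rewrite exprMn exprVn; ring.
rewrite E3 in H3.
(* The third absolute moment carries the factor (1 - p)^2 + p^2 <= 1. *)
have B1 : p * (12 * ((1 - p) * w) ^+ 3) + (1 - p) * (12 * (p * w) ^+ 3) <= 12 * (w * (h / v)).
  rewrite -w2.
  have -> : p * (12 * ((1 - p) * w) ^+ 3) + (1 - p) * (12 * (p * w) ^+ 3) =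
    12 * (w * (w ^+ 2 * (p * (1 - p)))) * ((1 - p) ^+ 2 + p ^+ 2) by ring.
  apply: ler_piMr; last nra.
  by rewrite w2; apply: mulr_ge0 => //; exact: mulr_ge0.
have B2 : w * (h / v) <= s / Num.sqrt delta * (h / delta) by rewrite ler_pM.
have B3 : (h / v) ^+ 2 <= (h / delta) ^+ 2 by rewrite lerXn2r ?nnegrE// (le_trans hv0).
move: H1 H2 H3; rewrite !ler_norml.
move: (Phi (y + _)) (Phi (y + p * w)) (heat _ _ _) (Phi y) (phi y) => A B C D f.
move=> /andP[H11 H12] /andP[H21 H22] /andP[H31 H32].
have := ler_wpM2l (ltW p0) H11; have := ler_wpM2l (ltW p0) H12.
have := ler_wpM2l q0 H21; have := ler_wpM2l q0 H22.
move=> K1 K2 K3 K4; apply/andP; split; lra.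
Qed.

(** Each exchange moves a variance [h] into the heat flow, so the induction on [N] runs over all
    [v >= delta], and the [N] errors add up. *)
Lemma heat_bin_expect (c p s h delta : R) (N : nat) (v : R) :
  0 < delta <= v -> 0 <= h -> 0 < p < 1 -> 0 <= s -> s ^+ 2 * (p * (1 - p)) = h ->
  `|bin_expect N p (fun k => heat c v ((k%:R - N%:R * p) * s)) - heat c (v + N%:R * h) 0|
    <= N%:R * (12 * (s / Num.sqrt delta * (h / delta)) + 12 * (h / delta) ^+ 2).
Proof.
move=> + h0 p01 s0 sh; set e := (X in _ <= _ * X); elim: N v => [|N IHN] v dv.
  rewrite /bin_expect big_ord1 bin0 !expr0 !mul1r !mul0r subrr mul0r addr0.
  by rewrite subrr normr0.
have /andP[d0 dv1] := dv; have /andP[p0 p1] := p01.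
have dv' : 0 < delta <= v + h by apply/andP; split => //; lra.
have := IHN _ dv'.
rewrite bin_expectS (_ : v + h + N%:R * h = v + N.+1%:R * h); last by rewrite -natr1; ring.
move=> H; have -> : N.+1%:R * e = e + N%:R * e by rewrite -natr1; ring.
set A := bin_expect N p _; set B := bin_expect N p _ in H; set C := heat _ _ _ in H *.
rewrite -(subrKA B A); apply: (le_trans (ler_normD _ _)); apply: lerD => //.
apply: bin_expect_dist; first by rewrite !ltW.
move=> k _; have := heat_step c ((k%:R - N%:R * p) * s) dv h0 p01 s0 sh.
rewrite (_ : (k.+1%:R - N.+1%:R * p) * s = (k%:R - N%:R * p) * s + (1 - p) * s); last first.
  by rewrite -!natr1; ring.
by rewrite (_ : (k%:R - N.+1%:R * p) * s = (k%:R - N%:R * p) * s - p * s)// -natr1; ring.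
Qed.

(** The exchanges end at variance 1 + delta instead of 1; since sqrt (1 + delta) lies between 1 and
    1 + delta, the Lipschitz bound on [Phi] absorbs the difference. *)
Lemma heat_relax (b delta : R) : 0 < delta <= 1 ->
  `|heat b (delta + 1) 0 - Phi b| <= `|b| * delta.
Proof.
move=> /andP[d0 d1]; rewrite /heat subr0; apply: (le_trans (Phi_lipschitz _ _)).
set q := Num.sqrt (delta + 1).
have q1 : 1 <= q by rewrite /q -[X in X <= _]sqrtr1 ler_wsqrtr//; lra.
have q2 : q <= 1 + delta.
  rewrite -[X in _ <= X](@ger0_norm _ (1 + delta)); last lra.
  by rewrite -sqrtr_sqr ler_wsqrtr//; nra.
have -> : b / q - b = b * (q^-1 - 1) by ring.
rewrite normrM ler_wpM2l//.
have q3 : q^-1 <= 1 by rewrite invf_le1; lra.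
rewrite ler0_norm ?subr_le0// opprB lerBlDr -lerBlDl -[X in _ <= X]mul1r.
rewrite ler_pdivlMr; last lra.
have : 0 <= (1 - delta) * (1 + delta - q) by rewrite mulr_ge0; lra.
nra.
Qed.

(** With [s = 1 / sqrt V] and [h = 1 / N], where [V] is the variance, the total error is O(1 / sqrt
    V + 1 / N) for fixed [delta], and V <= N. *)
Lemma heat_bin_expect_cvg (b delta e : R) : 0 < e -> 0 < delta <= 1 ->
  exists A : R, forall (N : nat) (p : R), 0 < p < 1 -> A <= N%:R * (p * (1 - p)) ->
  `|bin_expect N p (fun k =>
      heat b delta ((k%:R - N%:R * p) / Num.sqrt (N%:R * (p * (1 - p)))))
    - heat b (delta + 1) 0| <= e.
Proof.
move=> e0 /andP[d0 d1].
have sd0 : 0 < Num.sqrt delta by rewrite sqrtr_gt0.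
have [Q Q0 QE] : exists2 Q, 0 <= Q & 12 / (delta * Num.sqrt delta) = e / 2 * Q.
  exists (24 / (e * (delta * Num.sqrt delta))); first by rewrite divr_ge0// ltW// !mulr_gt0.
  by field; rewrite !gt_eqF.
have [S S0 SE] : exists2 S, 0 <= S & 12 / delta ^+ 2 = e / 2 * S.
  exists (24 / (e * delta ^+ 2)); first by rewrite divr_ge0// ltW// !mulr_gt0// exprn_gt0.
  by field; rewrite !gt_eqF.
(* [Q] and [S] make each error term at most e / 2; the 1 guarantees a positive variance. *)
exists (Q ^+ 2 + S + 1) => N p p01 AN; have /andP[p0 p1] := p01.
have Q20 := sqr_ge0 Q.
set V := N%:R * (p * (1 - p)) in AN *.
have V0 : 0 < V by lra.
have sV0 : 0 < Num.sqrt V by rewrite sqrtr_gt0.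
have pq0 : 0 < p * (1 - p) by rewrite mulr_gt0// subr_gt0.
have N0 : 0 < N%:R :> R by move: V0; rewrite /V pmulr_lgt0.
have VN : V <= N%:R by rewrite /V ler_piMr//; nra.
have s0 : 0 <= (Num.sqrt V)^-1 by rewrite invr_ge0 ltW.
have h0 : 0 <= N%:R^-1 :> R by rewrite invr_ge0 ltW.
have sh : (Num.sqrt V)^-1 ^+ 2 * (p * (1 - p)) = N%:R^-1.
  by rewrite exprVn sqr_sqrtr ?ltW// /V; field; rewrite !gt_eqF// subr_gt0.
have dd : 0 < delta <= delta by rewrite d0 lexx.
have := heat_bin_expect b N dd h0 p01 s0 sh; rewrite mulfV ?gt_eqF// => /le_trans; apply.
set s := (Num.sqrt V)^-1.
have -> : N%:R * (12 * (s / Num.sqrt delta * (N%:R^-1 / delta)) + 12 * (N%:R^-1 / delta) ^+ 2) =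
    12 / (delta * Num.sqrt delta) * s + 12 / delta ^+ 2 / N%:R.
  by field; rewrite !gt_eqF.
have e2 : 0 <= e / 2 by rewrite divr_ge0// ltW.
have E1 : 12 / (delta * Num.sqrt delta) * s <= e / 2.
  rewrite ler_pdivrMr// QE ler_wpM2l// -[X in X <= _](ger0_norm Q0) -sqrtr_sqr.
  apply: ler_wsqrtr; lra.
have E2 : 12 / delta ^+ 2 / N%:R <= e / 2 by rewrite ler_pdivrMr// SE ler_wpM2l//; lra.
lra.
Qed.

(* Smoothing: the indicator of x <= c is squeezed between the heat flows, run
   for a short time delta, from the indicators of x <= c - eta and x <= c + eta. *)
Theorem binomial_clt (c e : R) : 0 < e -> exists A : R, forall (N : nat) (p : R),
  0 < p < 1 -> A <= N%:R * (p * (1 - p)) ->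
  `|bin_expect N p (fun k => (((k%:R - N%:R * p) / Num.sqrt (N%:R * (p * (1 - p))) <= c)%R)%:R)
    - Phi c| <= e.
Proof.
(* Four errors [eta] arise: smoothing, exchange, excess variance and shift of the threshold. *)
move=> e0; have [eta eta0 etaE] : exists2 eta, 0 < eta & eta = e / 8 by exists (e / 8); lra.
have [K K0 [KN KP]] := Phi_tail eta0.
have eK : 0 < eta / K by rewrite divr_gt0.
have C0 : 0 < `|c| + eta by rewrite ltr_wpDl.
have [delta [d0 d1 dK dC]] : exists delta, [/\ 0 < delta, delta <= 1,
    Num.sqrt delta <= eta / K & (`|c| + eta) * delta <= eta].
  (* The first entry makes a shift by [eta] worth at least [K] standard deviations of the smoothing;
     the last one controls the excess variance. *)
  exists (Num.min ((eta / K) ^+ 2) (Num.min 1 (eta / (`|c| + eta)))); split.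
  - by rewrite !lt_min ltr01 exprn_gt0// divr_gt0.
  - by rewrite !ge_min lexx orbT.
  - rewrite -[X in _ <= X](ger0_norm (ltW eK)) -(sqrtr_sqr (eta / K)).
    by apply: ler_wsqrtr; rewrite ge_min lexx.
  - by rewrite mulrC -ler_pdivlMr// !ge_min lexx !orbT.
have sd0 : 0 < Num.sqrt delta by rewrite sqrtr_gt0.
have {}dK : K <= eta / Num.sqrt delta.
  by move: dK; rewrite ler_pdivlMr// => H; rewrite ler_pdivlMr// mulrC.
have d01 : 0 < delta <= 1 by rewrite d0.
have [A1 HA1] := heat_bin_expect_cvg (c + eta) eta0 d01.
have [A2 HA2] := heat_bin_expect_cvg (c - eta) eta0 d01.
exists (Num.max A1 A2) => N p p01; rewrite ge_max => /andP[/(HA1 _ _ p01) + /(HA2 _ _ p01)].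
set V := N%:R * (p * (1 - p)).
have p01' : 0 <= p <= 1 by move: p01 => /andP[/ltW -> /ltW ->].
have R1 := heat_relax (c + eta) d01; have R2 := heat_relax (c - eta) d01.
have {}R1 : `|heat (c + eta) (delta + 1) 0 - Phi (c + eta)| <= eta.
  apply: (le_trans R1); apply: le_trans dC; rewrite ler_wpM2r ?(ltW d0)//.
  by apply: (le_trans (ler_normD _ _)); rewrite (gtr0_norm eta0).
have {}R2 : `|heat (c - eta) (delta + 1) 0 - Phi (c - eta)| <= eta.
  apply: (le_trans R2); apply: le_trans dC; rewrite ler_wpM2r ?(ltW d0)//.
  by apply: (le_trans (ler_normB _ _)); rewrite (gtr0_norm eta0).
have L1 : `|Phi (c + eta) - Phi c| <= eta.
  by apply: (le_trans (Phi_lipschitz _ _)); rewrite addrAC subrr add0r gtr0_norm.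
have L2 : `|Phi (c - eta) - Phi c| <= eta.
  by apply: (le_trans (Phi_lipschitz _ _)); rewrite addrAC subrr add0r normrN gtr0_norm.
have U : bin_expect N p (fun k => (((k%:R - N%:R * p) / Num.sqrt V <= c)%R)%:R) <=
    bin_expect N p (fun k => heat (c + eta) delta ((k%:R - N%:R * p) / Num.sqrt V)) + eta.
  rewrite -bin_expectD; apply: bin_expect_le => // k _.
  set z := _ / Num.sqrt V; case: (leP z c) => zc /=; last by rewrite addr_ge0 ?Phi_ge0// ltW.
  rewrite -lerBlDr; apply: (le_trans KP); apply: Phi_le; apply: (le_trans dK).
  by rewrite ler_wpM2r ?invr_ge0 ?(ltW sd0)//; lra.
have L : bin_expect N p (fun k => heat (c - eta) delta ((k%:R - N%:R * p) / Num.sqrt V)) <=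
    bin_expect N p (fun k => (((k%:R - N%:R * p) / Num.sqrt V <= c)%R)%:R) + eta.
  rewrite -bin_expectD; apply: bin_expect_le => // k _.
  set z := _ / Num.sqrt V; case: (leP z c) => zc /=.
    by rewrite -[X in X <= _]addr0 lerD ?Phi_le1// ltW.
  rewrite add0r; apply: le_trans KN; apply: Phi_le; apply: (@le_trans _ _ (- (eta / Num.sqrt delta))).
    by rewrite -[X in _ <= X]mulNr ler_wpM2r ?invr_ge0 ?(ltW sd0)//; lra.
  by rewrite lerN2.
move: U L R1 R2 L1 L2.
set x1 := bin_expect _ _ _; set x2 := bin_expect _ _ _; set x3 := bin_expect _ _ _.
set x4 := heat _ _ _; set x5 := heat _ _ _; set x6 := Phi _; set x7 := Phi _; set x8 := Phi _.
clearbody x1 x2 x3 x4 x5 x6 x7 x8.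
clear -etaE => U L; rewrite !ler_norml.
move=> /andP[? ?] /andP[? ?] /andP[? ?] /andP[? ?] /andP[? ?] /andP[? ?].
by apply/andP; split; lra.
Qed.

End NormalCdf.

(** * Expansion of the mean number of matchings *)

Section Expansion.
Context {R : realType}.
Implicit Types (p K x : R) (n l m : nat).
Local Notation N n := 'C(n, 2).

(** The lower bound is ln y <= y - 1 at y = 1 / (1 + x). *)
Lemma ln1D_quadratic x : `|x| <= 2^-1 -> `|ln (1 + x) - x| <= 2 * x ^+ 2.
Proof.
rewrite ler_norml => /andP[x1 x2]; have x0 : 0 < 1 + x by lra.
have U : ln (1 + x) <= x by apply: le_ln1Dx; lra.
have L : - ln (1 + x) <= (1 + x)^-1 - 1.
  have := @le_ln1Dx R ((1 + x)^-1 - 1); rewrite addrCA subrr addr0 lnV ?posrE//; apply.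
  by rewrite ltrBrDl subrr invr_gt0.
have E : (1 + x)^-1 - 1 = - x + x ^+ 2 / (1 + x) by field; rewrite gt_eqF.
have B : x ^+ 2 / (1 + x) <= 2 * x ^+ 2.
  rewrite ler_pdivrMr// mulrAC -[X in X <= _]mul1r ler_wpM2r ?sqr_ge0//; lra.
have := sqr_ge0 x => x2'.
by rewrite ler_norml; apply/andP; split; lra.
Qed.

Lemma ln_prod (l : nat) (f : nat -> R) : (forall i, (i < l)%N -> 0 < f i) ->
  ln (\prod_(i < l) f i) = \sum_(i < l) ln (f i).
Proof.
elim: l => [|l IHl] f0; first by rewrite !big_ord0 ln1.
rewrite !big_ord_recr /= lnM ?posrE//; last exact: f0.
  by rewrite IHl// => i il; apply: f0; exact: ltnW.
by apply: prodr_gt0 => i _; apply: f0; apply: ltnW; rewrite ltnS.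
Qed.

Lemma bin_ratio (m k l : nat) p : 0 < p -> (l <= m)%N -> (l <= k)%N ->
  'C(m, l)%:R / ('C(k, l)%:R * p ^+ l) =
  \prod_(i < l) ((m%:R - i%:R) / (p * (k%:R - i%:R))) :> R.
Proof.
move=> p0 lm lk.
have ff j : (l <= j)%N -> 'C(j, l)%:R * (l`!)%:R = \prod_(i < l) (j%:R - i%:R) :> R.
  move=> lj; rewrite -natrM bin_ffact ffact_prod natr_prod; apply: eq_bigr => i _.
  by rewrite natrB// ltnW// (leq_trans (ltn_ord i)).
have fl : (l`!)%:R != 0 :> R by rewrite pnatr_eq0 -lt0n fact_gt0.
rewrite prodf_div big_split /= prodr_const card_ord -!ff//.
have Ck : 'C(k, l)%:R != 0 :> R by rewrite pnatr_eq0 -lt0n bin_gt0.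
by field; rewrite fl Ck expf_neq0// gt_eqF.
Qed.

Lemma n2_le_N n : (3 <= n)%N -> n%:R ^+ 2 / 4 <= (N n)%:R :> R.
Proof.
rewrite -(ler_nat R) bin2R => n3; nra.
Qed.

(** * Edge counts within [K] standard deviations of the mean *)

Section Typical.
Context (n l m : nat) (p K : R)
  (p01 : 0 < p < 1) (K0 : 0 <= K) (Kpn : 16 * (K + 1) ^+ 2 <= p ^+ 2 * n%:R)
  (l2n : (l.*2 <= n)%N)
  (mK : `|m%:R - (N n)%:R * p| <= K * Num.sqrt ((N n)%:R * (p * (1 - p)))).

Let p0 : 0 < p. Proof. by case/andP: p01. Qed.
Let p1 : p < 1. Proof. by case/andP: p01. Qed.

Lemma typical_pn : 16 * (K + 1) ^+ 2 <= p * n%:R.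
Proof.
apply: (le_trans Kpn); rewrite ler_wpM2r//; have := p0; have := p1; nra.
Qed.

Lemma typical_n : (16 <= n)%N.
Proof.
rewrite -(ler_nat R); have := typical_pn; have := p0; have := p1.
have : 0 <= n%:R :> R by []. have := K0; nra.
Qed.

Lemma typical_N : n%:R ^+ 2 / 4 <= (N n)%:R :> R.
Proof. by apply: n2_le_N; apply: leq_trans typical_n. Qed.

Lemma typical_n_le : n%:R <= p * (N n)%:R / 4.
Proof.
have := typical_pn; have := typical_N; have := p0; have := K0.
have : 16 <= n%:R :> R by rewrite ler_nat typical_n.
move=> n16 k0 q0 HN Hp.
have : p * (n%:R ^+ 2 / 4) <= p * (N n)%:R by rewrite ler_pM2l.
have : n%:R * (16 * (K + 1) ^+ 2) <= n%:R * (p * n%:R) by rewrite ler_wpM2l//; lra.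
have : n%:R * 16 <= n%:R * (16 * (K + 1) ^+ 2) by rewrite ler_wpM2l//; nra.
lra.
Qed.

Lemma typical_dev : `|m%:R - (N n)%:R * p| <= K * n%:R.
Proof.
apply: (le_trans mK); rewrite ler_wpM2l//.
rewrite -[X in _ <= X]ger0_norm// -sqrtr_sqr ler_wsqrtr//.
apply: (@le_trans _ _ (N n)%:R); first by rewrite ler_piMr//; have := p0; have := p1; nra.
rewrite bin2R; have : 16 <= n%:R :> R by rewrite ler_nat typical_n.
nra.
Qed.

Lemma typical_m : p * (N n)%:R / 2 <= m%:R.
Proof.
have := typical_dev; rewrite ler_norml => /andP[H _].
have := typical_pn; have := typical_N; have := p0; have := K0.
have n16 : 16 <= n%:R :> R by rewrite ler_nat typical_n.
move=> k0 q0 HN Hp.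
have : p * (n%:R ^+ 2 / 4) <= p * (N n)%:R by rewrite ler_pM2l.
have : n%:R * (16 * (K + 1) ^+ 2) <= n%:R * (p * n%:R) by rewrite ler_wpM2l//; lra.
have : n%:R * (16 * K) <= n%:R * (16 * (K + 1) ^+ 2) by rewrite ler_wpM2l//; nra.
move: H HN; set M := m%:R; set X := (N n)%:R; set y := n%:R => H HN h1 h2 h3.
have : K * y <= p * X / 4 by lra.
have : 0 <= p * X by rewrite mulr_ge0// ltW.
lra.
Qed.

Lemma typical_lm : (l.*2 <= m)%N.
Proof.
rewrite -(ler_nat R); have := typical_m; have := typical_n_le.
have : l.*2%:R <= n%:R :> R by rewrite ler_nat.
have : 0 <= n%:R :> R by [].
lra.
Qed.

(** The i-th factor of [bin_ratio] is [1 + x_ i]. Freezing the denominator gives [y_ i], which is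
    affine in i and can be summed exactly. *)
Let x_ i : R := (m%:R - (N n)%:R * p - (1 - p) * i%:R) / (p * ((N n)%:R - i%:R)).
Let y_ i : R := (m%:R - (N n)%:R * p - (1 - p) * i%:R) / (p * (N n)%:R).

Let nR : R := n%:R.
Let NR : R := (N n)%:R.

Let n16 : 16 <= nR. Proof. by rewrite ler_nat typical_n. Qed.
Let N0 : 0 < NR.
Proof. by apply: lt_le_trans typical_N; rewrite divr_gt0// exprn_gt0//; have := n16; rewrite /nR; lra. Qed.

Let il i : (i < l)%N -> (i%:R : R) <= nR / 2.
Proof.
move=> il; have : (i.*2 <= n)%N by apply: leq_trans l2n; rewrite leq_double ltnW.
by rewrite -(ler_nat R) -muln2 natrM /nR; lra.
Qed.

Let Ni i : (i < l)%N -> nR ^+ 2 / 8 <= NR - i%:R.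
Proof.
move=> /il; have := typical_N; rewrite -/NR -/nR; have := n16; nra.
Qed.

Let num_le i : (i < l)%N ->
  `|m%:R - (N n)%:R * p - (1 - p) * i%:R| <= (K + 1) * nR.
Proof.
move=> /il i2; have i0 : 0 <= i%:R :> R by [].
have q0 : 0 <= 1 - p by have := p1; lra.
apply: (le_trans (ler_normB _ _)); rewrite [(K + 1) * nR]mulrDl mul1r lerD ?typical_dev//.
rewrite ger0_norm ?mulr_ge0//; have := p0; have := n16; nra.
Qed.

Let pn0 : 0 < p * nR. Proof. by rewrite mulr_gt0 ?p0//; have := n16; lra. Qed.

Let x_le i : (i < l)%N -> `|x_ i| <= 8 * (K + 1) / (p * nR).
Proof.
move=> il'; have H1 := num_le il'; have H2 := Ni il'.
have D0 : 0 < NR - i%:R by apply: lt_le_trans H2; rewrite divr_gt0// exprn_gt0//; have := n16; lra.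
have pD0 : 0 < p * (NR - i%:R) by rewrite mulr_gt0 ?p0.
rewrite /x_ -/NR normrM normfV (gtr0_norm pD0) ler_pdivrMr//.
apply: (le_trans H1); rewrite mulrAC ler_pdivlMr//.
have : 8 * (K + 1) * p * (nR ^+ 2 / 8) <= 8 * (K + 1) * p * (NR - i%:R).
  by rewrite ler_wpM2l// !mulr_ge0 ?(ltW p0)//; have := K0; lra.
lra.
Qed.

Let x_half i : (i < l)%N -> `|x_ i| <= 2^-1.
Proof.
move=> /x_le /le_trans; apply; rewrite ler_pdivrMr//.
have := typical_pn; rewrite -/nR; have := K0; nra.
Qed.

Let xy_le i : (i < l)%N -> `|x_ i - y_ i| <= 16 * (K + 1) / (p * nR ^+ 2).
Proof.
move=> il'; have H1 := x_le il'; have H2 := Ni il'; have i2 := il il'.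
have D0 : 0 < NR - i%:R by apply: lt_le_trans H2; rewrite divr_gt0// exprn_gt0//; have := n16; lra.
have -> : x_ i - y_ i = x_ i * (i%:R / NR).
  by rewrite /x_ /y_ -/NR; field; rewrite !gt_eqF ?p0.
rewrite normrM (ger0_norm (_ : 0 <= i%:R / NR)); last by rewrite divr_ge0// ltW.
have iN : i%:R / NR <= 2 / nR.
  have nR0 : 0 < nR by have := n16; lra.
  rewrite ler_pdivrMr// mulrAC ler_pdivlMr//; have := typical_N; rewrite -/nR -/NR; nra.
have -> : 16 * (K + 1) / (p * nR ^+ 2) = 8 * (K + 1) / (p * nR) * (2 / nR).
  by field; rewrite !gt_eqF ?p0//; have := n16; lra.
by apply: ler_pM => //; rewrite divr_ge0// ltW.
Qed.

(** An arithmetic progression: the deviation of [m] gives the term linear in [beta], and l (l - 1) /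
    2 gives [beta ^+ 2 / 2] together with a small correction. *)
Let sum_y : \sum_(i < l) y_ i = 
  (m%:R - NR * p) / Num.sqrt (NR * (p * (1 - p))) * beta n l p
       - beta n l p ^+ 2 / 2 + (1 - p) * l%:R / (2 * (p * NR)).
Proof.
have pN0 : 0 < p * NR by rewrite mulr_gt0 ?p0.
have q0 : 0 < 1 - p by have := p1; lra.
rewrite /beta -/NR; set s := Num.sqrt ((1 - p) / (p * NR)).
have s0 : 0 < s by rewrite sqrtr_gt0 divr_gt0.
have s2 : s ^+ 2 = (1 - p) / (p * NR) by rewrite sqr_sqrtr// ltW// divr_gt0.
have -> : Num.sqrt (NR * (p * (1 - p))) = p * NR * s.
  have pNs : 0 <= p * NR * s by rewrite !mulr_ge0// ltW// p0.
  rewrite -[RHS](ger0_norm pNs) -sqrtr_sqr; congr Num.sqrt.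
  by rewrite exprMn s2; field; rewrite !gt_eqF ?p0.
rewrite exprMn s2.
have -> : \sum_(i < l) y_ i = l%:R * ((m%:R - NR * p) / (p * NR))
    - (1 - p) / (p * NR) * (l%:R * (l%:R - 1) / 2).
  elim: (l) => [|k IHk]; first by rewrite big_ord0 !mul0r mulr0 subr0.
  by rewrite big_ord_recr /= IHk /y_ -/NR -[k.+1%:R]natr1; field; rewrite !gt_eqF ?p0.
by field; rewrite !gt_eqF ?p0.
Qed.

Lemma log_mean_expansion : (m <= N n)%N ->
  `|ln ('C(m, l)%:R / ('C(N n, l)%:R * p ^+ l))
    - ((m%:R - (N n)%:R * p) / Num.sqrt ((N n)%:R * (p * (1 - p))) * beta n l p
       - beta n l p ^+ 2 / 2)| <= 80 * (K + 1) ^+ 2 / (p ^+ 2 * n%:R).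
Proof.
move=> mN; have lm : (l <= m)%N by apply: leq_trans typical_lm; rewrite -addnn leq_addr.
rewrite bin_ratio ?p0//; last exact: leq_trans lm mN.
have x1 i : (i < l)%N -> (m%:R - i%:R) / (p * ((N n)%:R - i%:R)) = 1 + x_ i.
  move=> il'; have H2 := Ni il'.
  have D0 : 0 < NR - i%:R by apply: lt_le_trans H2; rewrite divr_gt0// exprn_gt0//; have := n16; lra.
  by rewrite /x_ -/NR; field; rewrite !gt_eqF ?p0.
rewrite (@ln_prod l (fun i => (m%:R - i%:R) / (p * ((N n)%:R - i%:R)))); last first.
  move=> i il'; rewrite x1//; have := x_half il'; rewrite ler_norml => /andP[+ _]; lra.
rewrite -/NR; set T := _ - beta n l p ^+ 2 / 2.
have ET : T = \sum_(i < l) y_ i - (1 - p) * l%:R / (2 * (p * NR)) by rewrite sum_y /T; ring.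
have pN0 : 0 < p * NR by rewrite mulr_gt0 ?p0.
rewrite ET opprB addrCA -sumrB addrC; apply: (le_trans (ler_normD _ _)).
(* The error per factor: 2 x_i^2 from the logarithm, then |x_i - y_i| from freezing the denominator.
   There are at most n / 2 factors. *)
pose b := 128 * (K + 1) ^+ 2 / (p * nR) ^+ 2 + 16 * (K + 1) / (p * nR ^+ 2).
have S1 : `|\sum_(i < l) (ln ((m%:R - i%:R) / (p * (NR - i%:R))) - y_ i)| <= l%:R * b.
  apply: (le_trans (ler_norm_sum _ _ _)).
  rewrite [X in _ <= X](_ : _ = \sum_(i < l) b); last by rewrite sumr_const card_ord mulr_natl.
  apply: ler_sum => i _; have il' := ltn_ord i.
  rewrite x1// -(subrKA (x_ i)); apply: (le_trans (ler_normD _ _)).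
  rewrite /b lerD ?xy_le//; apply: (le_trans (ln1D_quadratic (x_half il'))).
  have : `|x_ i| ^+ 2 <= (8 * (K + 1) / (p * nR)) ^+ 2.
    by rewrite lerXn2r ?nnegrE ?x_le// divr_ge0 ?(ltW pn0)// mulr_ge0//; have := K0; lra.
  rewrite real_normK ?num_real// => H.
  have -> : 128 * (K + 1) ^+ 2 / (p * nR) ^+ 2 = 2 * (8 * (K + 1) / (p * nR)) ^+ 2.
    by field; rewrite !gt_eqF ?p0//; have := n16; lra.
  by rewrite ler_pM2l.
have lR : l%:R <= nR / 2.
  by move: l2n; rewrite -(ler_nat R) -muln2 natrM /nR; lra.
have nR0 : 0 < nR by have := n16; lra.
have b0 : 0 <= b.
  by rewrite addr_ge0// divr_ge0 ?mulr_ge0 ?exprn_ge0 ?(ltW p0) ?(ltW nR0)//; have := K0; lra.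
have S2 : `|(1 - p) * l%:R / (2 * (p * NR))| <= 1 / (p * nR).
  rewrite ger0_norm; last by rewrite divr_ge0 ?mulr_ge0 ?(ltW p0) ?(ltW N0)//; have := p1; lra.
  rewrite ler_pdivrMr ?mulr_gt0// mulrAC ler_pdivlMr// mul1r.
  have HN := typical_N; rewrite -/nR -/NR in HN.
  have H1 : (1 - p) * l%:R <= nR / 2.
    by apply: le_trans lR; rewrite ler_piMl//; have := p0; lra.
  have H2 : (1 - p) * l%:R * (p * nR) <= nR / 2 * (p * nR) by rewrite ler_wpM2r// ltW.
  apply: (le_trans H2); have : p * (nR ^+ 2 / 4) <= p * NR by rewrite ler_pM2l ?p0.
  lra.
have S3 : l%:R * b <= nR / 2 * b by rewrite ler_wpM2r.
rewrite addrC; apply: (le_trans (lerD S2 (le_trans S1 S3))).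
have -> : 80 * (K + 1) ^+ 2 / (p ^+ 2 * n%:R) =
   64 * (K + 1) ^+ 2 / (p ^+ 2 * nR) + 16 * (K + 1) ^+ 2 / (p ^+ 2 * nR) by rewrite /nR; ring.
have -> : 1 / (p * nR) + nR / 2 * b = 64 * (K + 1) ^+ 2 / (p ^+ 2 * nR) +
    (p + 8 * (K + 1) * p) / (p ^+ 2 * nR).
  by rewrite /b; field; rewrite !gt_eqF ?p0.
rewrite lerD2l ler_wpM2r ?invr_ge0 ?mulr_ge0 ?exprn_ge0 ?(ltW p0) ?(ltW nR0)//.
have := p0; have := p1; have := K0; nra.
Qed.

End Typical.
End Expansion.

(** * Concentration in the binomial random graph *)

Lemma gnp_probE (R : realType) (n : nat) (p : R) (A : set (graph n)) : 0 <= p <= 1 ->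
  gnp_prob n p A = (\sum_(G : graph n | G \in A) gnp_pmf p G)%:E.
Proof.
move=> p01; rewrite /gnp_prob p01 fsbig_mkcond (fsbigE (index_enum (graph n))) ?index_enum_uniq//=.
  rewrite (eq_bigl xpredT); last by move=> G; rewrite in_setT.
  rewrite [in RHS]big_mkcond -sumEFin; apply: eq_bigr => G _.
  by rewrite patchE; case: ifP.
by move=> G _ /negP[]; rewrite mem_index_enum.
Qed.

Lemma expectation_gnp (R : realType) (n : nat) (p : R) (X : graph n -> R) : 0 <= p <= 1 ->
  (forall G, 0 <= X G) ->
  ('E_(gnp_prob n p)[X] = (\sum_(G : graph n) gnp_pmf p G * X G)%:E)%E.
Proof.
move=> p01 X0; rewrite unlock.
have TE : [set: graph n] = \big[setU/set0]_(G <- index_enum (graph n)) [set G].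
  apply/seteqP; split=> // G _; rewrite -bigcup_seq; exists G => //=.
  by rewrite mem_index_enum.
rewrite TE ge0_integral_bigsetU//=.
- rewrite -sumEFin; apply: eq_bigr => G _.
  rewrite (eq_integral (cst (X G)%:E)); last by move=> H; rewrite inE => ->.
  rewrite integral_cst//= gnp_probE// -EFinM mulrC; congr (_ * _)%:E.
  rewrite (big_pred1 G)// => H /=; apply/idP/eqP => [|->]; last by rewrite inE.
  by rewrite inE.
- exact: index_enum_uniq.
- by move=> G H _ _ [K [/= -> ->]].
- by move=> G _; rewrite lee_fin.
Qed.

Section Gnp.
Context {R : realType} (n : nat).
Implicit Types (p : R) (G M : {set edge n}).
Local Notation N := 'C(n, 2).

Lemma sum_by_card (f : {set edge n} -> R) :
  \sum_(G : {set edge n}) f G = \sum_(k < N.+1) \sum_(G : {set edge n} | #|G| == k) f G.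
Proof.
rewrite (partition_big (fun G => inord #|G| : 'I_N.+1) xpredT)//=.
apply: eq_bigr => k _; apply: eq_bigl => G.
have cG : (#|G| < N.+1)%N by rewrite ltnS -card_edge max_card.
by apply/eqP/eqP => [<-|cGk]; [rewrite inordK|apply: val_inj; rewrite /= inordK].
Qed.

Lemma card_graphs (m : nat) : #|[pred G : {set edge n} | #|G| == m]| = 'C(N, m).
Proof. by rewrite -card_edge -card_draws; apply: eq_card => G; rewrite !inE. Qed.

Lemma gnp_pmfE p G : gnp_pmf p G = p ^+ #|G| * (1 - p) ^+ (N - #|G|).
Proof.
rewrite /gnp_pmf (bigID (mem G)) /=; congr (_ * _).
  by rewrite (eq_bigr (fun=> p)) => [|e ->//]; rewrite prodr_const.
rewrite (eq_bigr (fun=> 1 - p)) => [|e /negbTE ->//]; rewrite prodr_const; congr (_ ^+ _).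
rewrite -card_edge -(cardC (mem G)) addKn.
by apply: eq_card => e; rewrite !inE.
Qed.

(** The number of edges follows the binomial law, to which the central limit theorem above
    applies. *)
Lemma sum_gnp_card p (F : nat -> R) :
  \sum_(G : {set edge n}) gnp_pmf p G * F #|G| = bin_expect N p F.
Proof.
rewrite sum_by_card; apply: eq_bigr => k _.
rewrite (eq_bigr (fun=> p ^+ k * (1 - p) ^+ (N - k) * F k)); last first.
  by move=> G /eqP cG; rewrite gnp_pmfE cG.
rewrite sumr_const (_ : #|_| = 'C(N, k)); first by rewrite -mulr_natl; ring.
exact: card_graphs.
Qed.

Lemma sum_gnp_superset p M :
  \sum_(G : {set edge n} | M \subset G) gnp_pmf p G = p ^+ #|M|.
Proof.
(* Giving weight 0 to the absence of an edge of [M] removes from the expanded product exactly the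
   graphs not containing [M]. *)
transitivity (\prod_(e : edge n) (p + (if e \in M then 0 else 1 - p))).
  rewrite bigA_distr [RHS](bigID (fun G : {set edge n} => M \subset G)) /=.
  rewrite [X in _ = _ + X]big1 ?addr0.
    apply: eq_bigr => G /fintype.subsetP MG; rewrite /gnp_pmf.
    apply: eq_bigr => e _; case: ifPn => // eG; case: ifPn => // /MG.
    by rewrite (negbTE eG).
  move=> G /fintype.subsetPn[e eM eG].
  by rewrite (bigD1 e)//= (negbTE eG) eM mul0r.
rewrite (bigID (mem M)) /= [X in _ * X]big1 ?mulr1.
  by rewrite (eq_bigr (fun=> p)) ?prodr_const// => e ->; rewrite addr0.
by move=> e /negbTE ->; rewrite addrC subrK.
Qed.

Lemma lambdaE (l : nat) p : 0 <= p <= 1 -> lambda n l p = (nbm n l)%:R * p ^+ l.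
Proof.
move=> p01; rewrite /lambda expectation_gnp//=.
transitivity (\sum_(G : {set edge n}) \sum_(M in exts (@is_matching n) finset.set0 l | M \subset G)
   gnp_pmf p G).
  apply: eq_bigr => G _; rewrite nb_matchingsE /nb_sub sumr_const mulr_natr; congr (_ *+ _).
  by apply: eq_card => M; rewrite inE [RHS]unfold_in /= mem_exts0 andbCA andbA andbC andbA.
rewrite (exchange_big_dep (mem (exts (@is_matching n) finset.set0 l))) /=; last by move=> ? ? _ /andP[].
rewrite (eq_bigr (fun=> p ^+ l)) => [|M Ml].
  by rewrite sumr_const mulr_natl.
move: (Ml); rewrite mem_exts0 => /andP[mM /eqP <-]; rewrite -sum_gnp_superset.
by apply: eq_bigl => G; rewrite mM eqxx.
Qed.

End Gnp.

(** * Concentration given the number of edges, and the logarithm of the count *)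

Section Concentration.
Context {R : realType}.
Implicit Types (p e delta K : R) (n l m : nat).
Local Notation N n := 'C(n, 2).

Lemma variance_small e : 0 < e -> exists A : R, forall n l m p, 0 < p < 1 ->
  A <= p ^+ 2 * n%:R -> (l.*2 <= n)%N -> p * (N n)%:R / 2 <= m%:R -> (m <= N n)%N ->
  n%:R <= p * (N n)%:R / 4 ->
  \sum_(G : {set edge n} | #|G| == m) ((nb_matchings l G)%:R - mean_m R n l m) ^+ 2
    <= e * ('C(N n, m)%:R * mean_m R n l m ^+ 2).
Proof.
move=> e0; pose d := Num.min (e / 4) 4^-1.
have [d0 d4 de] : [/\ 0 < d, d <= 4^-1 & 4 * d <= e].
  split; first by rewrite lt_min divr_gt0//= invr_gt0.
    by rewrite ge_min lexx orbT.
  by rewrite mulrC -ler_pdivlMr// ge_min lexx.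
clearbody d; exists (200 / d ^+ 3) => n l m p /andP[p0 p1] Ap l2n mlb mN nN.
have pd0 : 0 < p * d by rewrite mulr_gt0.
pose J := (Num.truncn (4 / (p * d))).+1.
have J0 : (0 < J)%N by [].
have JL : 4 / (p * d) <= J%:R by rewrite ltW// truncnS_gt.
have JU : J%:R <= 5 / (p * d).
  have : (Num.truncn (4 / (p * d)))%:R <= 4 / (p * d) by rewrite truncn_le// divr_ge0// ltW.
  have : 1 <= 1 / (p * d) by rewrite ler_pdivlMr//; nra.
  have -> : 5 / (p * d) = 4 / (p * d) + 1 / (p * d) by field; rewrite !gt_eqF.
  rewrite /J -natr1; lra.
have NR0 : 0 <= (N n)%:R :> R by [].
have n0 : 0 <= n%:R :> R by [].
have l2m : (l.*2 <= m)%N.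
  rewrite -(ler_nat R); have : l.*2%:R <= n%:R :> R by rewrite ler_nat.
  have : 0 <= p * (N n)%:R by rewrite mulr_ge0// ltW.
  lra.
have H1 : 8 * J%:R ^+ 2 <= d * n%:R.
  have J2 : J%:R ^+ 2 <= (5 / (p * d)) ^+ 2 by rewrite lerXn2r ?nnegrE// divr_ge0// ltW.
  apply: (@le_trans _ _ (8 * (5 / (p * d)) ^+ 2)); first by rewrite ler_pM2l.
  have -> : 8 * (5 / (p * d)) ^+ 2 = 200 / d ^+ 3 * (d / p ^+ 2) by field; rewrite !gt_eqF.
  have -> : d * n%:R = p ^+ 2 * n%:R * (d / p ^+ 2) by field; rewrite !gt_eqF.
  by rewrite ler_wpM2r// divr_ge0 ?exprn_ge0// ltW.
have H2 : (N n - m)%:R <= d * J%:R * (m - l.*2 + 1)%:R.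
  have B1 : p * (N n)%:R / 4 <= (m - l.*2 + 1)%:R.
    rewrite natrD natrB//; have : l.*2%:R <= n%:R :> R by rewrite ler_nat.
    lra.
  have B2 : 4 / p <= d * J%:R.
    by move: JL; rewrite !ler_pdivrMr//; lra.
  apply: (@le_trans _ _ (4 / p * (p * (N n)%:R / 4))).
    rewrite (_ : 4 / p * (p * (N n)%:R / 4) = (N n)%:R); last by field; rewrite gt_eqF.
    by rewrite ler_nat leq_subr.
  by apply: ler_pM => //; rewrite divr_ge0 ?mulr_ge0// ltW.
apply: le_trans (@matching_variance R n l m l2n l2m mN J d _ J0 H1 H2) _; first by rewrite d0.
by rewrite ler_wpM2r// mulr_ge0// sqr_ge0.
Qed.

Definition zscore n p (G : {set edge n}) : R :=
  (#|G|%:R - (N n)%:R * p) / Num.sqrt ((N n)%:R * (p * (1 - p))).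

(** Chebyshev's inequality at each typical number of edges, with relative variance at most e
    delta^2, averaged over the number of edges. *)
Lemma matching_concentration K delta e : 0 <= K -> 0 < delta -> 0 < e ->
  exists A : R, forall n l p, 0 < p < 1 -> A <= p ^+ 2 * n%:R -> (l.*2 <= n)%N ->
  \sum_(G : {set edge n} | (`|zscore p G| <= K) &&
     (delta * mean_m R n l #|G| < `|(nb_matchings l G)%:R - mean_m R n l #|G| |)) gnp_pmf p G
  <= e.
Proof.
move=> K0 d0 e0; have ed0 : 0 < e * delta ^+ 2 by rewrite mulr_gt0// exprn_gt0.
have [A HA] := variance_small ed0.
exists (Num.max A (16 * (K + 1) ^+ 2)) => n l p p01; rewrite ge_max => /andP[Ap Kp] l2n.
have /andP[p0 p1] := p01; have p01' : 0 <= p <= 1 by rewrite !ltW.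
rewrite big_mkcond sum_by_card.
(* Written as a binomial expectation, the constant [e] can be compared with the left side edge count
   by edge count. *)
rewrite -[X in _ <= X](bin_expect_cst (N n) p e).
apply: ler_sum => m _.
have c0 : 0 <= p ^+ m * (1 - p) ^+ (N n - m).
  by rewrite mulr_ge0// exprn_ge0// ?subr_ge0 ltW.
have [mK|mK] := boolP (`|(m%:R - (N n)%:R * p) / Num.sqrt ((N n)%:R * (p * (1 - p)))| <= K); last first.
  rewrite big1; first by rewrite mulr_ge0 ?(ltW e0)// -mulrA mulr_ge0.
  by move=> G /eqP cG; rewrite /zscore cG (negbTE mK).
have mN : (m <= N n)%N by rewrite -ltnS.
have n16 := typical_n p01 K0 Kp.
have NR0 : 0 < (N n)%:R :> R by rewrite ltr0n bin_gt0; exact: leq_trans n16.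
have V0 : 0 < Num.sqrt ((N n)%:R * (p * (1 - p))).
  by rewrite sqrtr_gt0 !mulr_gt0// subr_gt0.
have {}mK : `|m%:R - (N n)%:R * p| <= K * Num.sqrt ((N n)%:R * (p * (1 - p))).
  by move: mK; rewrite normrM normfV (gtr0_norm V0) ler_pdivrMr.
have lm : (l.*2 <= m)%N by exact: typical_lm mK.
have lm1 : (l <= m)%N by apply: leq_trans lm; rewrite -addnn leq_addr.
have HV := HA n l m p p01 Ap l2n (typical_m p01 K0 Kp mK) mN (typical_n_le p01 K0 Kp).
set mu := mean_m R n l m in HV *.
have mu0 : 0 < mu.
  rewrite /mu /mean_m divr_gt0 ?mulr_gt0 ?ltr0n ?nbm_gt0 ?bin_gt0//.
  exact: leq_trans lm1 mN.
have dm0 : 0 < (delta * mu) ^+ 2 by rewrite exprn_gt0// mulr_gt0.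
set c := _ * _ in c0 *.
apply: (@le_trans _ _ (\sum_(G : {set edge n} | #|G| == m)
    c / (delta * mu) ^+ 2 * ((nb_matchings l G)%:R - mu) ^+ 2)).
  apply: ler_sum => G /eqP cG; rewrite cG -/mu.
  case: ifPn => [/andP[_ H]|_]; last by rewrite mulr_ge0 ?sqr_ge0// divr_ge0// ltW.
  rewrite gnp_pmfE cG -/c -mulrA ler_peMr// mulrC ler_pdivlMr// mul1r.
  rewrite -[X in _ <= X]real_normK ?num_real// lerXn2r ?nnegrE//; last exact: ltW.
  by rewrite mulr_ge0// ltW.
rewrite -mulr_sumr; apply: (le_trans (ler_wpM2l _ HV)); first by rewrite divr_ge0// ltW.
rewrite le_eqVlt; apply/orP; left; apply/eqP; rewrite /c.
move: mu0 d0; clear; move=> mu0 d0; field.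
by rewrite !gt_eqF.
Qed.

(** The ratio X / lambda splits into X / mu, within [delta] of 1, and mu / lambda, whose logarithm
    is expanded above. In particular X > 0, so the extended logarithm is finite. *)
Lemma log_matchings_close n l p K delta G : 0 < p < 1 -> 0 <= K ->
  16 * (K + 1) ^+ 2 <= p ^+ 2 * n%:R -> (l.*2 <= n)%N -> 0 < delta <= 2^-1 ->
  0 < beta n l p -> `|@zscore n p G| <= K ->
  `|(nb_matchings l G)%:R - mean_m R n l #|G| | <= delta * mean_m R n l #|G| ->
  exists2 y : R, log_matchings n l p G = y%:E &
    `|y - zscore p G| <= (2 * delta + 80 * (K + 1) ^+ 2 / (p ^+ 2 * n%:R)) / beta n l p.
Proof.
move=> p01 K0 Kp l2n /andP[d0 d2] b0 zK HX; have /andP[p0 p1] := p01.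
have n16 := typical_n p01 K0 Kp.
have NR0 : 0 < (N n)%:R :> R by rewrite ltr0n bin_gt0; exact: leq_trans n16.
have V0 : 0 < Num.sqrt ((N n)%:R * (p * (1 - p))).
  by rewrite sqrtr_gt0 !mulr_gt0// subr_gt0.
have mN : (#|G| <= N n)%N by rewrite -card_edge max_card.
have mK : `|#|G|%:R - (N n)%:R * p| <= K * Num.sqrt ((N n)%:R * (p * (1 - p))).
  by move: zK; rewrite /zscore normrM normfV (gtr0_norm V0) ler_pdivrMr.
have lm : (l.*2 <= #|G|)%N by exact: typical_lm mK.
have lm1 : (l <= #|G|)%N by apply: leq_trans lm; rewrite -addnn leq_addr.
have HL := log_mean_expansion p01 K0 Kp l2n mK mN.
set r := _ / (_ * p ^+ l) in HL.
have r0 : 0 < r.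
  by rewrite divr_gt0 ?mulr_gt0 ?exprn_gt0 ?ltr0n ?bin_gt0//; exact: leq_trans lm1 mN.
set mu := mean_m R n l #|G| in HX.
have T0 : 0 < (nbm n l)%:R :> R by rewrite ltr0n nbm_gt0.
have mu0 : 0 < mu.
  rewrite /mu /mean_m divr_gt0 ?mulr_gt0 ?ltr0n ?bin_gt0//; first by rewrite -(ltr0n R).
  exact: leq_trans lm1 mN.
set X : R := (nb_matchings l G)%:R in HX *.
pose u := (X - mu) / mu.
have ud : `|u| <= delta by rewrite normrM normfV (gtr0_norm mu0) ler_pdivrMr.
have u2 : `|u| <= 2^-1 by apply: le_trans d2.
have Hu := ln1D_quadratic u2.
have u0 : 0 < 1 + u by move: u2; rewrite ler_norml => /andP[]; lra.
have XE : expR (beta n l p ^+ 2 / 2) * X / lambda n l p = expR (beta n l p ^+ 2 / 2) * ((1 + u) * r).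
  rewrite lambdaE; last by rewrite !ltW.
  have CN : 'C(N n, l)%:R != 0 :> R by rewrite pnatr_eq0 -lt0n bin_gt0; exact: leq_trans lm1 mN.
  have Cm : 'C(#|G|, l)%:R != 0 :> R by rewrite pnatr_eq0 -lt0n bin_gt0.
  have -> : 1 + u = X / mu by rewrite /u; field; rewrite gt_eqF.
  rewrite /r /mu /mean_m; field.
  by rewrite expf_neq0 ?(gt_eqF p0)// CN Cm gt_eqF.
exists ((beta n l p ^+ 2 / 2 + (ln (1 + u) + ln r)) / beta n l p).
  rewrite /log_matchings -/X XE lne_EFin; last first.
    by apply: mulr_gt0; [exact: expR_gt0|exact: mulr_gt0].
  rewrite -EFinM; congr (_ / _)%:E.
  have ur0 : 0 < (1 + u) * r by rewrite mulr_gt0.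
  rewrite lnM ?posrE ?expR_gt0// (lnM (x := 1 + u)) ?posrE//.
  by rewrite expRK.
have -> : (beta n l p ^+ 2 / 2 + (ln (1 + u) + ln r)) / beta n l p - zscore p G =
  (ln (1 + u) + (ln r - (zscore p G * beta n l p - beta n l p ^+ 2 / 2))) / beta n l p.
  by field; rewrite gt_eqF.
rewrite normrM normfV (gtr0_norm b0) ler_wpM2r ?invr_ge0 ?(ltW b0)//.
apply: (le_trans (ler_normD _ _)); rewrite lerD//.
have : `|ln (1 + u)| <= `|ln (1 + u) - u| + `|u|.
  by rewrite -{1}(subrK u (ln (1 + u))) ler_normD.
have : u ^+ 2 <= delta / 2.
  by rewrite -real_normK ?num_real// expr2 ler_pM.
lra.
Qed.

End Concentration.

(** * Limit law *)

Section Main.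
Context {R : realType}.
Implicit Types (x e p K : R) (n l : nat).
Local Notation N n := 'C(n, 2).

Lemma gnp_union n p (A B C D F : pred {set edge n}) : 0 <= p <= 1 ->
  (forall G, A G -> [|| B G, C G, D G | F G]) ->
  \sum_(G : {set edge n} | A G) gnp_pmf p G <=
  \sum_(G : {set edge n} | B G) gnp_pmf p G + \sum_(G : {set edge n} | C G) gnp_pmf p G
  + \sum_(G : {set edge n} | D G) gnp_pmf p G + \sum_(G : {set edge n} | F G) gnp_pmf p G.
Proof.
move=> p01 ABCD; 
have E (Q : pred {set edge n}) : \sum_(G : {set edge n} | Q G) gnp_pmf p G =
    \sum_(G : {set edge n}) if Q G then gnp_pmf p G else 0 by rewrite big_mkcond.
rewrite (E A) (E B) (E C) (E D) (E F) -!big_split /=; apply: ler_sum => G _.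
have g0 : 0 <= gnp_pmf p G by exact: gnp_pmf_ge0.
have := ABCD G; case: (A G) => [/(_ isT)|_]; last by rewrite !addr_ge0//; case: ifP.
by do 4![case: ifP => //= _]; rewrite ?addr0 ?add0r// -?addrA ?lerDl ?addr_ge0.
Qed.

Lemma gnp_clt x e : 0 < e -> exists A : R, forall n p, 0 < p < 1 ->
  A <= (N n)%:R * (p * (1 - p)) ->
  `|\sum_(G : {set edge n} | zscore p G <= x) gnp_pmf p G - Phi x| <= e.
Proof.
move=> e0; have [A HA] := binomial_clt x e0; exists A => n p p01 /(HA _ _ p01).
rewrite -sum_gnp_card (_ : \sum_G _ = \sum_(G : {set edge n} | zscore p G <= x) gnp_pmf p G)//.
rewrite [RHS]big_mkcond; apply: eq_bigr => G _; rewrite /zscore.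
by case: (_ <= x); rewrite ?mulr1 ?mulr0.
Qed.

(** Off the events |Z| > K and poor concentration, the statistic is within [eta] of Z, so its
    distribution function is squeezed between those of Z at x - eta and x + eta. The lower bound
    [b0] controls the division by [beta]. *)
Lemma log_matchings_cdf x e b0 : 0 < e -> 0 < b0 -> exists A : R, forall n l p, 0 < p < 1 ->
  A <= p ^+ 2 * n%:R -> A <= (N n)%:R * (p * (1 - p)) -> (l.*2 <= n)%N ->
  b0 <= beta n l p ->
  `|\sum_(G : {set edge n} | (log_matchings n l p G <= x%:E)%E) gnp_pmf p G - Phi x| <= e.
Proof.
move=> e0 b00; have [eta eta0 etaE] : exists2 eta, 0 < eta & eta = e / 8 by exists (e / 8); lra.
have [K K0 [KN KP]] := Phi_tail eta0.
have eb0 : 0 < eta * b0 by rewrite mulr_gt0.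
(* [delta] and later [A6] each take half of the allowed error [eta * b0] in the logarithm. *)
have [delta /andP[d0 d2] dE] : exists2 delta, 0 < delta <= 2^-1 & 4 * delta <= eta * b0.
  exists (Num.min 2^-1 (eta * b0 / 4)); first by rewrite lt_min invr_gt0 ltr0n divr_gt0//= ge_min lexx.
  by rewrite mulrC -ler_pdivlMr// ge_min lexx orbT.
have [A1 HA1] := matching_concentration (ltW K0) d0 eta0.
have [A2 HA2] := gnp_clt (- K) eta0.
have [A3 HA3] := gnp_clt K eta0.
have [A4 HA4] := gnp_clt (x + eta) eta0.
have [A5 HA5] := gnp_clt (x - eta) eta0.
have [A6 HA6 HA6'] : exists2 A6, 16 * (K + 1) ^+ 2 <= A6 & 160 * (K + 1) ^+ 2 <= eta * b0 * A6.
  exists (Num.max (16 * (K + 1) ^+ 2) (160 * (K + 1) ^+ 2 / (eta * b0))); first by rewrite le_max lexx.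
  by rewrite [X in _ <= X]mulrC -ler_pdivrMr// le_max lexx orbT.
exists (Num.max A1 (Num.max A2 (Num.max A3 (Num.max A4 (Num.max A5 A6))))) => n l p p01.
rewrite !ge_max => /and5P[B1 _ _ _ /andP[_ B6]] /and5P[_ B2 B3 B4 /andP[B5 _]] l2n bb.
have {}HA1 := HA1 n l p p01 B1 l2n.
have {}HA2 := HA2 n p p01 B2; have {}HA3 := HA3 n p p01 B3.
have {}HA4 := HA4 n p p01 B4; have {}HA5 := HA5 n p p01 B5.
have p01' : 0 <= p <= 1 by move: p01 => /andP[/ltW -> /ltW ->].
have Kp := le_trans HA6 B6.
have D0 : 0 < p ^+ 2 * n%:R by apply: lt_le_trans Kp; rewrite mulr_gt0// exprn_gt0//; lra.
have bp : 0 < beta n l p by exact: lt_le_trans bb.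
have gap : (2 * delta + 80 * (K + 1) ^+ 2 / (p ^+ 2 * n%:R)) / beta n l p <= eta.
  rewrite ler_pdivrMr//; apply: (@le_trans _ _ (eta * b0)); last by rewrite ler_pM2l.
  have : 80 * (K + 1) ^+ 2 / (p ^+ 2 * n%:R) <= eta * b0 / 2.
    rewrite ler_pdivrMr//; have : eta * b0 * A6 <= eta * b0 * (p ^+ 2 * n%:R) by rewrite ler_pM2l.
    lra.
  lra.
have close (G : {set edge n}) : - K < zscore p G -> zscore p G <= K ->
    ~~ (delta * mean_m R n l #|G| < `|(nb_matchings l G)%:R - mean_m R n l #|G| |) ->
    exists2 y : R, log_matchings n l p G = y%:E & `|y - zscore p G| <= eta.
  move=> z1 z2; rewrite -leNgt => HX.
  have zK : `|zscore p G| <= K by rewrite ler_norml (ltW z1).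
  have d02 : 0 < delta <= 2^-1 by rewrite d0.
  have [y yE yz] := log_matchings_close p01 (ltW K0) Kp l2n d02 bp zK HX.
  by exists y => //; apply: le_trans gap.
pose Bad (G : {set edge n}) := (`|zscore p G| <= K) &&
   (delta * mean_m R n l #|G| < `|(nb_matchings l G)%:R - mean_m R n l #|G| |).
have tail : \sum_(G : {set edge n} | ~~ (zscore p G <= K)) gnp_pmf p G <= 2 * eta.
  have := sum_gnp_pmf n p; rewrite (bigID (fun G : graph n => zscore p G <= K)) /=.
  move: HA3; rewrite ler_norml => /andP[? ?] ?; lra.
have U : \sum_(G : {set edge n} | (log_matchings n l p G <= x%:E)%E) gnp_pmf p G <=
    \sum_(G : {set edge n} | zscore p G <= x + eta) gnp_pmf p G
    + \sum_(G : {set edge n} | zscore p G <= - K) gnp_pmf p G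
    + \sum_(G : {set edge n} | ~~ (zscore p G <= K)) gnp_pmf p G
    + \sum_(G : {set edge n} | Bad G) gnp_pmf p G.
  apply: gnp_union => // G yx.
  have [//|z1] := leP (zscore p G) (- K); first by rewrite orbT.
  have [z2|z2] := leP (zscore p G) K; last by rewrite !orbT.
  have [bG|bG] := boolP (Bad G); first by rewrite !orbT.
  rewrite /= !orbF; move: bG; rewrite /Bad ler_norml (ltW z1) z2 /= => bG.
  have [y yE] := close G z1 z2 bG; move: yx; rewrite yE lee_fin => yx.
  rewrite ler_norml => /andP[? ?]; lra.
have L : \sum_(G : {set edge n} | zscore p G <= x - eta) gnp_pmf p G <=
    \sum_(G : {set edge n} | (log_matchings n l p G <= x%:E)%E) gnp_pmf p G
    + \sum_(G : {set edge n} | zscore p G <= - K) gnp_pmf p G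
    + \sum_(G : {set edge n} | ~~ (zscore p G <= K)) gnp_pmf p G
    + \sum_(G : {set edge n} | Bad G) gnp_pmf p G.
  apply: gnp_union => // G yx.
  have [//|z1] := leP (zscore p G) (- K); first by rewrite orbT.
  have [z2|z2] := leP (zscore p G) K; last by rewrite !orbT.
  have [bG|bG] := boolP (Bad G); first by rewrite !orbT.
  rewrite /= !orbF; move: bG; rewrite /Bad ler_norml (ltW z1) z2 /= => bG.
  have [y yE] := close G z1 z2 bG; rewrite yE lee_fin.
  rewrite ler_norml => /andP[? ?]; lra.
have L1 : `|Phi (x + eta) - Phi x| <= eta.
  by apply: (le_trans (Phi_lipschitz _ _)); rewrite addrAC subrr add0r gtr0_norm.
have L2 : `|Phi (x - eta) - Phi x| <= eta.
  by apply: (le_trans (Phi_lipschitz _ _)); rewrite addrAC subrr add0r normrN gtr0_norm.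
move: U L HA1 HA2 HA4 HA5 L1 L2 tail KN; rewrite -/Bad.
set s1 := \sum_(G | (_ <= x%:E)%E) _; set s2 := \sum_(G | _ <= x + eta) _.
set s3 := \sum_(G | _ <= - K) _; set s4 := \sum_(G | ~~ _) _; set s5 := \sum_(G | Bad G) _.
set s6 := \sum_(G | _ <= x - eta) _.
move: (Phi x) (Phi (x + eta)) (Phi (x - eta)) (Phi (- K)) => f1 f2 f3 f4.
clearbody s1 s2 s3 s4 s5 s6; clear -etaE => U L H1.
rewrite !ler_norml => /andP[? ?] /andP[? ?] /andP[? ?] /andP[? ?] /andP[? ?] ? ?.
by apply/andP; split; lra.
Qed.

(** From p >= n^(-1/4) one gets p sqrt n >= n^(1/4), hence p^2 n >= sqrt n, which tends to
    infinity. *)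
Lemma sqr_p_n_large (eps : R) (p : nat -> R) : 0 < eps ->
  (\forall n \near \oo, n%:R `^ (- 8^-1 + eps) <= p n) ->
  forall A : R, \forall n \near \oo, A <= p n ^+ 2 * n%:R.
Proof.
move=> e0 hp A.
have hA : \forall n \near \oo, A ^+ 2 <= n%:R :> R.
  by near=> n; near: n; exact: nbhs_infty_ger.
near=> n.
have n0 : (0 < n)%N by near: n; exact: nbhs_infty_gt.
have nR0 : 0 < n%:R :> R by rewrite ltr0n.
have n1 : 1 <= n%:R :> R by rewrite ler1n.
have An : A ^+ 2 <= n%:R :> R by near: n; exact: hA.
have hpn : n%:R `^ (- 8^-1 + eps) <= p n by near: n; exact: hp.
have H1 : n%:R `^ (- 4^-1) <= p n.
  by apply: le_trans hpn; rewrite ler_powR//; lra.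
have -> : p n ^+ 2 * n%:R = (p n * Num.sqrt n%:R) ^+ 2 by rewrite exprMn sqr_sqrtr.
have H2 : n%:R `^ (4^-1) <= p n * Num.sqrt n%:R.
  rewrite -powR12_sqrt//; apply: le_trans (ler_wpM2r _ H1); last exact: powR_ge0.
  rewrite -powRD; last by apply/implyP => _; rewrite gt_eqF.
  by rewrite ler_powR//; lra.
apply: (@le_trans _ _ ((n%:R `^ (4^-1)) ^+ 2)); last first.
  by rewrite lerXn2r ?nnegrE ?powR_ge0// (le_trans (powR_ge0 _ _) H2).
rewrite -powR_mulrn ?powR_ge0// -powRrM (_ : 4^-1 * 2%:R = 2^-1 :> R); last lra.
rewrite powR12_sqrt//; apply: le_trans (ler_norm A) _.
by rewrite -sqrtr_sqr ler_wsqrtr.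
Unshelve. all: by end_near. Qed.

End Main.

Theorem theorem3 (R : realType) (eps : R) (heps : 0 < eps < 8^-1)
    (p : nat -> R) (l : nat -> nat)
    (hp01 : \forall n \near \oo, 0 < p n < 1)
    (hp1 : (fun n => 1 - p n : R^o) =Omega_\oo (fun=> 1 : R^o))
    (hp : \forall n \near \oo, n%:R `^ (- 8^-1 + eps) <= p n)
    (hl : \forall n \near \oo, (0 < l n)%N /\ (l n)%:R <= n%:R / 2 :> R)
    (hlO : (fun n => (l n)%:R : R^o) =Omega_\oo
           (fun n => n%:R * Num.sqrt (p n) : R^o)) :
  cvg_in_distribution (P := fun n => gnp_prob n (p n))
    (fun n => log_matchings n (l n) (p n)) (normal_prob 0 1).
Proof.
move=> x _.
have large := sqr_p_n_large (proj1 (andP heps)) hp.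
have [c c0 hc] : exists2 c : R, 0 < c & \forall n \near \oo, c <= 1 - p n.
  move: hp1; rewrite eqOmegaE qualifE => /asboolP[c c0 hc]; exists c => //.
  near=> n; have : 0 < p n < 1 by near: n; exact: hp01.
  move=> /andP[p0 p1]; have : c * `|1 : R| <= `|1 - p n| by near: n; exact: hc.
  by rewrite normr1 mulr1 gtr0_norm// subr_gt0.
have [k k0 hk] : exists2 k : R, 0 < k & \forall n \near \oo, k * (n%:R * Num.sqrt (p n)) <= (l n)%:R.
  move: hlO; rewrite eqOmegaE qualifE => /asboolP[k k0 hk]; exists k => //.
  near=> n.
  have : k * `|n%:R * Num.sqrt (p n)| <= `|(l n)%:R : R| by near: n; exact: hk.
  by rewrite !ger0_norm// mulr_ge0// sqrtr_ge0.
rewrite [X in _ --> X](_ : _ = (Phi x)%:E); last by rewrite -PhiE set_itvE.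
pose r n : R := \sum_(G : {set edge n} | (log_matchings n (l n) (p n) G <= x%:E)%E) gnp_pmf (p n) G.
suff H : r n @[n --> \oo] --> Phi x.
  apply: cvg_trans (_ : (r n)%:E @[n --> \oo] --> (Phi x)%:E); last by apply: cvg_EFin => //; near=> n.
  apply: near_eq_cvg; near=> n.
  have p01 : 0 < p n < 1 by near: n; exact: hp01.
  rewrite /distribution /pushforward /= gnp_probE; last by move: p01 => /andP[/ltW -> /ltW ->].
  by congr EFin; apply: eq_bigl => G; apply/idP/idP; rewrite inE.
apply/cvgrPdist_le => e e0.
(* The eventual lower bound for [beta]: l >= k n sqrt p and 1 - p >= c, while N <= n^2. *)
have b00 : 0 < k * Num.sqrt c by rewrite mulr_gt0// sqrtr_gt0.
have [A HA] := log_matchings_cdf x e0 b00.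
near=> n; rewrite distrC.
have p01 : 0 < p n < 1 by near: n; exact: hp01.
have /andP[p0 p1] := p01.
have cn : c <= 1 - p n by near: n; exact: hc.
have kn : k * (n%:R * Num.sqrt (p n)) <= (l n)%:R by near: n; exact: hk.
have [l0 ln2] : (0 < l n)%N /\ (l n)%:R <= n%:R / 2 :> R by near: n; exact: hl.
have n3 : (3 <= n)%N by near: n; exact: nbhs_infty_ge.
have n3R : 3 <= n%:R :> R by rewrite ler_nat.
have A1 : A <= p n ^+ 2 * n%:R by near: n; exact: large.
(* This makes the variance large: N >= n^2 / 4 and 1 - p >= c give N p (1 - p) >= c p n^2 / 4 >= c
   p^2 n / 4 >= A. *)
have A2 : 4 * A / c <= p n ^+ 2 * n%:R by near: n; exact: large.
have NL := @n2_le_N R n n3.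
have N0 : 0 < 'C(n, 2)%:R :> R by apply: lt_le_trans NL; rewrite divr_gt0// exprn_gt0//; lra.
apply: HA => //.
- move: A2; rewrite ler_pdivrMr// => A2.
  have h1 : p n * c <= p n * (1 - p n) by rewrite ler_pM2l.
  have h2 : n%:R ^+ 2 / 4 * (p n * c) <= 'C(n, 2)%:R * (p n * (1 - p n)).
    by apply: ler_pM => //; rewrite ?mulr_ge0 ?divr_ge0 ?sqr_ge0 ?(ltW p0) ?(ltW c0).
  have h3 : p n ^+ 2 * n%:R <= p n * n%:R ^+ 2.
    by rewrite -mulrA ler_wpM2l ?(ltW p0)//; nra.
  have h4 : p n ^+ 2 * n%:R * c <= p n * n%:R ^+ 2 * c by rewrite ler_wpM2r// ltW.
  lra.
- by rewrite -(ler_nat R) -muln2 natrM; lra.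
- rewrite /beta; apply: le_trans (ler_wpM2r _ kn); last exact: sqrtr_ge0.
  rewrite -!mulrA ler_pM2l// -sqrtrM ?(ltW p0)//.
  (* The factor sqrt p in the lower bound for [l] cancels the [p] in the denominator of [beta]. *)
  have -> : p n * ((1 - p n) / (p n * 'C(n, 2)%:R)) = (1 - p n) / 'C(n, 2)%:R.
    by field; rewrite !gt_eqF.
  rewrite -[X in X * Num.sqrt (_ / _)]ger0_norm// -sqrtr_sqr -sqrtrM ?sqr_ge0//.
  rewrite ler_wsqrtr// mulrA ler_pdivlMr//.
  apply: (@le_trans _ _ (c * n%:R ^+ 2)).
    by rewrite ler_pM2l// bin2R; nra.
  by rewrite mulrC ler_wpM2l// sqr_ge0.
Unshelve. all: by end_near. Qed.
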